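(* Let $K$ be an imaginary quadratic field with ring of integers $\mathcal{O}_K$. Then $\mathcal{O}_K$ has a Euclidean ideal if and only if $K=\mathbb{Q}(\sqrt{-D})$ with $D\in\{1,2,3,5,7,11,15\}$. Among these, $K$ has class number $1$ for $D\in\{1,2,3,7,11\}$ and class number $2$ for $D\in\{5,15\}$. Moreover, in each of these seven cases the unique ideal class that generates the class group of $\mathcal{O}_K$ is norm-Euclidean.
   Context: Let $R$ be a Dedekind domain with fraction field $K$, and let $E$ denote the set of fractional ideals of $R$ in $K$ that contain $R$. A nonzero ideal $C\subseteq R$ is called Euclidean if there exists a function $\psi:E\to\mathbb{N}$ (with $0\in\mathbb{N}$) such that for all $I\in E$ and all $x\in IC\setminus C$ there exists $y\in C$ with $\psi((x+y)^{-1}IC)<\psi(I)$; such $\psi$ is a Euclidean algorithm for $C$. A function $\psi$ is a Euclidean algorithm for $C$ if and only if it is one for every ideal in the ideal class of $C$, so one speaks of a Euclidean ideal class. An ideal (class) $C$ is norm-Euclidean if the function $I\mapsto \mathrm{Nm}(I^{-1})=|R/I^{-1}|$ on $E$ is a Euclidean algorithm for $C$; for $R=\mathcal{O}_K$ with $K$ imaginary quadratic this is equivalent to: for every $I\in E$ and $x\in IC\setminus C$ there is $y\in C$ with $\mathrm{Nm}(x+y)<\mathrm{Nm}(C)$, where $\mathrm{Nm}$ is the absolute norm. Here $D$ denotes a squarefree positive integer. *)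

(* Defs.v *)
(* the imaginary quadratic field Q(sqrt(-D)) is realised
   inside the algebraic complex numbers algC; its ring of integers is
   K ∩ Aint (algebraic integers, algnum.v).  Subsets of K are predicates
   algC -> Prop. *)
From mathcomp Require Import all_boot all_order all_algebra all_field.
Set Implicit Arguments. Unset Strict Implicit. Unset Printing Implicit Defensive.
Import Order.TTheory GRing.Theory Num.Theory.
Local Open Scope ring_scope.

Definition squarefree (D : nat) : Prop :=
  forall p : nat, prime p -> ~~ (p * p %| D)%N.

Definition sqrtmD (D : nat) : algC := sqrtC (- (D%:R)).

Definition QF (D : nat) (x : algC) : Prop :=
  exists a b : rat, x = ratr a + ratr b * sqrtmD D.

Definition OK (D : nat) (x : algC) : Prop := QF D x /\ x \in Aint.

Definition int_ideal (D : nat) (C : algC -> Prop) : Prop :=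
  [/\ forall x, C x -> OK D x,
      C 0,
      exists x, C x /\ x != 0,
      forall x y, C x -> C y -> C (x + y)
    & forall r x, OK D r -> C x -> C (r * x)].

Definition frac_ideal (D : nat) (I : algC -> Prop) : Prop :=
  [/\ forall x, I x -> QF D x,
      I 0,
      exists x, I x /\ x != 0,
      forall x y, I x -> I y -> I (x + y)
    & forall r x, OK D r -> I x -> I (r * x)] /\
  exists d, [/\ OK D d, d != 0 & forall x, I x -> OK D (d * x)].

Definition Eset (D : nat) (I : algC -> Prop) : Prop :=
  frac_ideal D I /\ forall x, OK D x -> I x.

Definition prodset (I J : algC -> Prop) (z : algC) : Prop :=
  exists (n : nat) (a b : 'I_n -> algC),
    [/\ forall i, I (a i), forall i, J (b i) & z = \sum_(i < n) a i * b i].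

Definition scaleset (a : algC) (I : algC -> Prop) (z : algC) : Prop :=
  exists w, I w /\ z = a * w.

Definition euclid_alg (D : nat) (C : algC -> Prop)
    (psi : (algC -> Prop) -> nat) : Prop :=
  forall I, Eset D I ->
  forall x, prodset I C x -> ~ C x ->
  exists y, C y /\ (psi (scaleset (x + y)^-1 (prodset I C)) < psi I)%N.

Definition euclidean_ideal (D : nat) (C : algC -> Prop) : Prop :=
  int_ideal D C /\ exists psi, euclid_alg D C psi.

Definition has_euclidean_ideal (D : nat) : Prop :=
  exists C, euclidean_ideal D C.

Definition finv (D : nat) (I : algC -> Prop) (z : algC) : Prop :=
  QF D z /\ forall w, I w -> OK D (z * w).

Definition ideal_index (D : nat) (J : algC -> Prop) (n : nat) : Prop :=
  exists r : 'I_n -> algC,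
    [/\ forall i, OK D (r i),
        forall i j, J (r i - r j) -> i = j
      & forall z, OK D z -> exists i, J (z - r i)].

(* C is norm-Euclidean: psi(I) = Nm(I^-1) = |O_K / I^-1| is a Euclidean
   algorithm for C (psi given relationally since the index is unique) *)
Definition norm_euclidean (D : nat) (C : algC -> Prop) : Prop :=
  int_ideal D C /\
  forall I, Eset D I ->
  forall x, prodset I C x -> ~ C x ->
  exists y, C y /\
    exists m n : nat,
      [/\ ideal_index D (finv D (scaleset (x + y)^-1 (prodset I C))) m,
          ideal_index D (finv D I) n & (m < n)%N].

Definition ideal_equiv (D : nat) (I J : algC -> Prop) : Prop :=
  exists a, [/\ QF D a, a != 0 & forall z, J z <-> scaleset a I z].

Fixpoint ideal_pow (D : nat) (C : algC -> Prop) (k : nat) : algC -> Prop :=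
  match k with
  | 0 => OK D
  | k'.+1 => prodset (ideal_pow D C k') C
  end.

Definition generates_class_group (D : nat) (C : algC -> Prop) : Prop :=
  forall I, frac_ideal D I -> exists k, ideal_equiv D I (ideal_pow D C k).

Definition has_class_number (D : nat) (n : nat) : Prop :=
  exists r : 'I_n -> (algC -> Prop),
    [/\ forall i, frac_ideal D (r i),
        forall i j, ideal_equiv D (r i) (r j) -> i = j
      & forall I, frac_ideal D I -> exists i, ideal_equiv D I (r i)].

(* Main.v *)
(** Every ideal J of K has a norm N(J) > 0 with J conj(J) = N(J) O_K, and a Z-basis
    in which the norm is N(J) Q for a reduced integral form Q = (A, B, C), that is
    0 <= B <= A <= C, of the same discriminant as K.  The covering radius of the
    lattice J, squared, is N(J) rho with rho = A C (A + C - B) / (4 A C - B^2).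

    If rho < 1, every point of K is at norm less than N(J) from J; as the norm is
    multiplicative, (x + y)^-1 I J then has larger norm than I for a suitable y,
    and J is norm-Euclidean.  If rho > 1, all points near the circumcentre h of a
    fundamental triangle are at norm at least N(J) from J.  When N(I) is small,
    I J has a point x near h, and no (x + y)^-1 I J with y in J has larger norm than I:
    a Euclidean algorithm would descend forever among such ideals I.

    There are few reduced forms with rho < 1.  They leave the seven fields, with
    rho < 1 in all cases except for principal ideals when D is 5 or 15; those do not
    generate the class group. *)

Require Import Defs.
From mathcomp Require Import all_boot all_order all_algebra all_field.
From mathcomp Require Import boolp zify ring lra.
Set Implicit Arguments.
Unset Strict Implicit.
Unset Printing Implicit Defensive.
Import Order.TTheory GRing.Theory Num.Theory.
Local Open Scope ring_scope.

(** * Integers *)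

Lemma ex_minimal (P : nat -> Prop) : (exists n, P n) ->
  exists2 n, P n & forall m, P m -> (n <= m)%N.
Proof.
case=> n Pn; have exP : exists n, `[<P n>] by exists n; apply/asboolP.
case: (ex_minnP exP) => m /asboolP Pm m_min; exists m => // k Pk.
by apply/m_min/asboolP.
Qed.

Lemma int_subgroup_cyclic (H : int -> Prop) :
  (forall x y, H x -> H y -> H (x - y)) -> (exists x, H x /\ x != 0) ->
  exists2 d : nat, (0 < d)%N & forall x, H x <-> (d %| x)%Z.
Proof.
move=> HB [x0 [Hx0 x0_neq0]]; have H0 : H 0 by rewrite -(subrr x0); apply: HB.
have HN x : H x -> H (- x) by rewrite -sub0r; apply: HB.
have H_abs x : H x -> H `|x|%N by rewrite abszE; case: (ger0P x) => _ // /HN.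
have H_mul x (n : int) : H x -> H (n * x).
  move=> Hx; have Hnat (k : nat) : H (k%:Z * x).
    by elim: k => [|k IH]; rewrite ?mul0r // intS mulrDl mul1r -[_ * _]opprK; apply/HB/HN.
  by case: n => k; rewrite ?NegzE ?mulNr; [|apply: HN]; apply: Hnat.
have [|d [d_gt0 Hd] d_min] := @ex_minimal (fun n => (0 < n)%N /\ H n).
  by exists `|x0|%N; rewrite absz_gt0; split=> //; apply: H_abs.
exists d => // x; split=> [Hx|/dvdzP[n ->]]; last exact: H_mul.
have Hmod : H (x %% d)%Z.
  by rewrite -[(x %% d)%Z](addKr ((x %/ d)%Z * d)) -divz_eq addrC; apply/HB/H_mul.
apply/dvdz_mod0P/eqP/negPn/negP => mod_neq0.
suff : (d <= `|(x %% d)%Z|)%N.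
  by have := ltz_pmod x (d_gt0 : 0 < d%:Z); have := modz_ge0 x; lia.
by apply: d_min; split; [rewrite absz_gt0 | apply: H_abs].
Qed.

Lemma eq_small_dvdz (d u v : nat) :
  (u < d)%N -> (v < d)%N -> (d %| u%:Z - v%:Z)%Z -> u = v.
Proof. by move=> ud vd; rewrite -eqz_mod_dvd !modz_nat !modn_small // => /eqP[]. Qed.

(** * Positive definite binary quadratic forms *)

Definition qform (R : pzRingType) (A B C x y : R) : R :=
  A * x ^+ 2 + B * x * y + C * y ^+ 2.

Definition qform_absdisc (R : pzRingType) (A B C : R) : R :=
  4 * A * C - B ^+ 2.

(* For a reduced form the triangle (0,0), (1,0), (0,1) is not obtuse, hence its
   circumradius is the covering radius of the lattice of integral points. *)
Definition qform_reduced (R : numDomainType) (A B C : R) : bool :=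
  [&& 0 < A, 0 <= B, B <= A & A <= C].

Definition qform_sqradius (F : fieldType) (A B C : F) : F :=
  A * C * (A + C - B) / qform_absdisc A B C.

Lemma qform_reduced_int (R : numDomainType) (A B C : int) :
  qform_reduced (A%:~R : R) B%:~R C%:~R = qform_reduced A B C.
Proof. by rewrite /qform_reduced ltr0z ler0z !ler_int. Qed.

Lemma qform_reducedZ (R : numDomainType) (r A B C : R) : 0 < r ->
  qform_reduced (r * A) (r * B) (r * C) = qform_reduced A B C.
Proof.
by move=> r_gt0; rewrite /qform_reduced pmulr_rgt0 // pmulr_rge0 // !ler_pM2l.
Qed.

Lemma qform_absdisc_int (R : pzRingType) (A B C : int) :
  qform_absdisc (A%:~R : R) B%:~R C%:~R = (qform_absdisc A B C)%:~R.
Proof. by rewrite /qform_absdisc rmorphB rmorphXn !rmorphM. Qed.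

Section Covering.
Variables (F : archiRealFieldType) (A B C : F).
Local Notation Q := (qform A B C).
Local Notation Delta := (qform_absdisc A B C).
Local Notation rho := (qform_sqradius A B C).

Lemma qform_reduced_absdisc : qform_reduced A B C -> A * C *+ 3 <= Delta.
Proof.
case/and4P=> A_gt0 B_ge0 leBA leAC.
have : 0 <= A * (C - A) by rewrite mulr_ge0 ?subr_ge0 // ltW.
have : 0 <= (A - B) * (A + B) by rewrite mulr_ge0 ?subr_ge0 ?addr_ge0 // ltW.
by rewrite /qform_absdisc; lra.
Qed.

Lemma qform_reduced_absdisc_gt0 : qform_reduced A B C -> 0 < Delta.
Proof.
move=> redQ; apply: lt_le_trans (qform_reduced_absdisc redQ).
case/and4P: redQ => A_gt0 _ _ leAC.
by rewrite pmulrn_lgt0 // mulr_gt0 // (lt_le_trans A_gt0).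
Qed.

Lemma qform_sqradius_lt : qform_reduced A B C -> rho < C.
Proof.
move=> redQ; rewrite ltr_pdivrMr ?qform_reduced_absdisc_gt0 //.
have := qform_reduced_absdisc redQ; have /and4P[A_gt0 B_ge0 leBA leAC] := redQ.
have C_gt0 := lt_le_trans A_gt0 leAC.
rewrite mulrAC [ltRHS]mulrC ltr_pM2r // => le_Delta.
have : 0 <= A * (C - A) by rewrite mulr_ge0 ?subr_ge0 // ltW.
have : 0 <= A * B by rewrite mulr_ge0 // ltW.
have : 0 < A * C by rewrite mulr_gt0.
by move: le_Delta; lra.
Qed.

(* If (s0, t0) is the circumcentre of the triangle (0,0), (1,0), (0,1), then
   [s A + t C - Q (s, t) = rho - Q (s - s0, t - t0)]. *)
Lemma qform_power_le (s t : F) : 0 < A -> 0 < Delta -> s * A + t * C - Q s t <= rho.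
Proof.
move=> A_gt0 Delta_gt0; rewrite ler_pdivlMr // -subr_ge0 -(pmulr_rge0 _ A_gt0).
have -> : A * (A * C * (A + C - B) - (s * A + t * C - Q s t) * Delta)
  = (Delta * (2 * A * s + B * t - A) ^+ 2 + (Delta * t - A * (2 * C - B)) ^+ 2) / 4.
  by rewrite /qform /qform_absdisc; field.
by rewrite divr_ge0 // addr_ge0 // ?sqr_ge0 // mulr_ge0 ?sqr_ge0 // ltW.
Qed.

Lemma qform_triangle_cover (s t : F) : 0 < A -> 0 < Delta ->
    0 <= s -> 0 <= t -> s + t <= 1 ->
  [\/ Q s t <= rho, Q (s - 1) t <= rho | Q s (t - 1) <= rho].
Proof.
move=> A_gt0 Delta_gt0 s_ge0 t_ge0 st_le1; apply/or3P.
rewrite -!ge_min; apply: le_trans (qform_power_le s t A_gt0 Delta_gt0).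
set m := Num.min _ _.
have /and3P[m0 m1 m2] : [&& m <= Q s t, m <= Q (s - 1) t & m <= Q s (t - 1)].
  by rewrite !ge_min !lexx ?orbT.
have -> : s * A + t * C - Q s t
    = m + ((1 - s - t) * (Q s t - m) + s * (Q (s - 1) t - m) + t * (Q s (t - 1) - m)).
  by rewrite /qform; ring.
by rewrite lerDl !addr_ge0 ?mulr_ge0 ?subr_ge0 //; lra.
Qed.

(* The unit square is cut into the triangle above and its point reflection. *)
Lemma qform_cover (s t : F) : 0 < A -> 0 < Delta ->
  exists i j : int, Q (s - i%:~R) (t - j%:~R) <= rho.
Proof.
move=> A_gt0 Delta_gt0.
have below (n m : int) (x y : F) :
    n%:~R <= x -> m%:~R <= y -> x - n%:~R + (y - m%:~R) <= 1 ->
    exists i j : int, Q (x - i%:~R) (y - j%:~R) <= rho.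
  rewrite -[n%:~R <= _]subr_ge0 -[m%:~R <= _]subr_ge0 => nx my xy_le1.
  have [le_rho|le_rho|le_rho] := qform_triangle_cover A_gt0 Delta_gt0 nx my xy_le1.
  - by exists n, m.
  - by exists (n + 1), m; rewrite rmorphD opprD addrA.
  - by exists n, (m + 1); rewrite rmorphD opprD addrA.
have := floor_itv s; have := floor_itv t; rewrite !rmorphD /=.
set n := Num.floor s; set m := Num.floor t => /andP[mt tm] /andP[ns sn].
have [st_le1|st_gt1] := leP (s - n%:~R + (t - m%:~R)) 1; first exact: below st_le1.
have [|||i [j le_rho]] := below (- (n + 1)) (- (m + 1)) (- s) (- t);
  rewrite ?rmorphN ?rmorphD /=; try lra.
by exists (- i), (- j); move: le_rho; congr (_ <= rho); rewrite /qform; ring.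
Qed.

Lemma qform_corner_ge0 (i j : int) : qform_reduced A B C ->
  0 <= A * (i * (i - 1))%:~R + B * (i * j)%:~R + C * (j * (j - 1))%:~R.
Proof.
case/and4P=> A_gt0 B_ge0 leBA leAC.
have int_ge0 (k : int) : 0 <= (k * (k - 1))%:~R :> F by rewrite ler0z; nia.
have [ij_ge0|ij_lt0] := leP 0 (i * j).
  have C_gt0 := lt_le_trans A_gt0 leAC.
  by rewrite !addr_ge0 // mulr_ge0 ?int_ge0 ?ler0z // ltW.
have -> : A * (i * (i - 1))%:~R + B * (i * j)%:~R + C * (j * (j - 1))%:~R
    = A * (((i + j) * (i + j - 1))%:~R + (- (i * j))%:~R)
      + (A - B) * (- (i * j))%:~R + (C - A) * (j * (j - 1))%:~R by ring.
have nij_ge0 : 0 <= (- (i * j))%:~R :> F by rewrite ler0z oppr_ge0 ltW.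
by rewrite !addr_ge0 // mulr_ge0 ?subr_ge0 ?addr_ge0 // ltW.
Qed.

Lemma qform_hole : qform_reduced A B C ->
  exists s t : F, forall i j : int, rho <= Q (s - i%:~R) (t - j%:~R).
Proof.
move=> redQ; have Delta_neq0 := lt0r_neq0 (qform_reduced_absdisc_gt0 redQ).
exists (C * (2 * A - B) / Delta), (A * (2 * C - B) / Delta) => i j.
rewrite -subr_ge0; have := qform_corner_ge0 i j redQ; congr (0 <= _).
by move: Delta_neq0; rewrite /qform /qform_sqradius /qform_absdisc => ?; field.
Qed.

End Covering.

(** * The field [Q(sqrt(-D))] *)

Local Notation ratC := (@ratr algC).

Lemma ratC_inj : injective ratC.
Proof. exact: fmorph_inj. Qed.

Lemma conjC_ratr (a : rat) : (ratC a)^* = ratC a.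
Proof. exact/conj_Crat/Crat_rat. Qed.

Lemma ratr_Aint (a : rat) : ratC a \in Aint -> exists m : int, a = m%:~R.
Proof.
move=> aA; have /intrP[m am] := Cint_rat_Aint (Crat_rat a) aA.
by exists m; apply: ratC_inj; rewrite am ratr_int.
Qed.

Lemma conjCM_ratr (a : rat) (x : algC) : (ratC a * x)^* = ratC a * x^*.
Proof. by rewrite (rmorphM Num.conj) /= conjC_ratr. Qed.

Lemma conjC_comb (x y : rat) (a b : algC) :
  (ratC x * a + ratC y * b)^* = ratC x * a^* + ratC y * b^*.
Proof. by rewrite (rmorphD Num.conj) /= !conjCM_ratr. Qed.

Lemma comb_sub_int (x y : rat) (i j : int) (a b : algC) :
  ratC x * a + ratC y * b - (i%:~R * a + j%:~R * b)
  = ratC (x - i%:~R) * a + ratC (y - j%:~R) * b.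
Proof. by rewrite !(rmorphB ratC) /= !ratr_int; ring. Qed.

(* [getCrat] is a junk value outside of [Crat]; [x * x^*] is rational for [x] in
   an imaginary quadratic field. *)
Definition normK (x : algC) : rat := getCrat (x * x^*).

Definition polarK (x y : algC) : rat := normK (x + y) - normK x - normK y.

Lemma normKN (x : algC) : normK (- x) = normK x.
Proof. by rewrite /normK rmorphN mulrNN. Qed.

Lemma normK0 : normK 0 = 0.
Proof. by apply: ratC_inj; rewrite /normK mul0r -(rmorph0 ratC) getCratK ?Crat_rat. Qed.

Section ImaginaryQuadraticField.
Variables (D : nat) (D_gt0 : (0 < D)%N).
Local Notation s := (sqrtmD D).

Lemma sqrtmD_sqr : s ^+ 2 = - D%:R.
Proof. exact: sqrtCK. Qed.

Lemma conjC_sqrtmD : s^* = - s.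
Proof.
have sR : s \notin Num.real.
  apply/negP => /(real_exprn_even_ge0 (n := 2))/(_ isT).
  by rewrite sqrtmD_sqr oppr_ge0 lern0 -leqn0 leqNgt D_gt0.
have : (s^* - s) * (s^* + s) = 0.
  by rewrite -subr_sqr -rmorphXn /= sqrtmD_sqr rmorphN /= conjC_nat subrr.
move/eqP; rewrite mulf_eq0 subr_eq0 addr_eq0 => /orP[/eqP/CrealP|/eqP//].
by rewrite (negbTE sR).
Qed.

Lemma ratr_sqrtmD_mul (a b c d : rat) :
  (ratC a + ratC b * s) * (ratC c + ratC d * s)
  = ratC (a * c - D%:R * b * d) + ratC (a * d + b * c) * s.
Proof.
transitivity (ratC a * ratC c + ratC b * ratC d * s ^+ 2 + ratC (a * d + b * c) * s).
  by ring.
by rewrite sqrtmD_sqr; ring.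
Qed.

Lemma conjC_ratr_sqrtmD (a b : rat) : (ratC a + ratC b * s)^* = ratC a - ratC b * s.
Proof. by rewrite (rmorphD Num.conj) /= conjCM_ratr conjC_ratr conjC_sqrtmD mulrN. Qed.

Lemma QF_rat (a : rat) : QF D (ratC a).
Proof. by exists a, 0; rewrite rmorph0 mul0r addr0. Qed.

Lemma QF_int (m : int) : QF D m%:~R.
Proof. by rewrite -ratr_int; apply: QF_rat. Qed.

Lemma QFD (x y : algC) : QF D x -> QF D y -> QF D (x + y).
Proof. by move=> [a [b ->]] [c [d ->]]; exists (a + c), (b + d); ring. Qed.

Lemma QFN (x : algC) : QF D x -> QF D (- x).
Proof. by move=> [a [b ->]]; exists (- a), (- b); ring. Qed.

Lemma QFB (x y : algC) : QF D x -> QF D y -> QF D (x - y).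
Proof. by move=> Kx /QFN; apply: QFD. Qed.

Lemma QFM (x y : algC) : QF D x -> QF D y -> QF D (x * y).
Proof.
by move=> [a [b ->]] [c [d ->]]; rewrite ratr_sqrtmD_mul; do 2!eexists; reflexivity.
Qed.

Lemma QF_conj (x : algC) : QF D x -> QF D x^*.
Proof. by move=> [a [b ->]]; exists a, (- b); rewrite conjC_ratr_sqrtmD; ring. Qed.

Lemma mul_conjC_QF (a b : rat) :
  (ratC a + ratC b * s) * (ratC a + ratC b * s)^* = ratC (a ^+ 2 + D%:R * b ^+ 2).
Proof.
have -> : (ratC a + ratC b * s)^* = ratC a + ratC (- b) * s.
  by rewrite conjC_ratr_sqrtmD; ring.
by rewrite ratr_sqrtmD_mul; ring.
Qed.

Lemma normKE (x : algC) : QF D x -> ratC (normK x) = x * x^*.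
Proof. by move=> [a [b ->]]; rewrite /normK getCratK // mul_conjC_QF Crat_rat. Qed.

Lemma polarKE (x y : algC) : QF D x -> QF D y ->
  ratC (polarK x y) = x * y^* + y * x^*.
Proof.
move=> Kx Ky; rewrite !(rmorphB ratC) /= !normKE //; last exact: QFD.
by rewrite rmorphD /=; ring.
Qed.

Lemma normK_rat (a : rat) : normK (ratC a) = a ^+ 2.
Proof.
by apply: ratC_inj; rewrite normKE ?conjC_ratr ?(rmorphXn ratC) //; exact: QF_rat.
Qed.

Lemma normK_nat (n : nat) : normK n%:R = n%:R ^+ 2.
Proof. by rewrite -(rmorph_nat ratC) normK_rat. Qed.

Lemma normK_ge0 (x : algC) : QF D x -> 0 <= normK x.
Proof. by move=> Kx; rewrite -(ler0q algC) normKE // mul_conjC_ge0. Qed.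

Lemma normK_gt0 (x : algC) : QF D x -> (0 < normK x) = (x != 0).
Proof. by move=> Kx; rewrite -(ltr0q algC) normKE // mul_conjC_gt0. Qed.

Lemma normKM (x y : algC) : QF D x -> QF D y -> normK (x * y) = normK x * normK y.
Proof.
move=> Kx Ky; apply: ratC_inj.
rewrite (rmorphM ratC) /= !normKE //; last exact: QFM.
by rewrite rmorphM mulrACA.
Qed.

Lemma QFV (x : algC) : QF D x -> QF D x^-1.
Proof.
move=> Kx; have [->|x_neq0] := eqVneq x 0; first by rewrite invr0; apply: (QF_int 0).
have -> : x^-1 = ratC (normK x)^-1 * x^*.
  by rewrite (fmorphV ratC) /= normKE // invfM mulfVK // conjC_eq0.
by apply: QFM; [apply: QF_rat | apply: QF_conj].
Qed.

Lemma normKV (x : algC) : QF D x -> normK x^-1 = (normK x)^-1.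
Proof.
move=> Kx; apply: ratC_inj.
rewrite (fmorphV ratC) /= !normKE //; last exact: QFV.
by rewrite (fmorphV Num.conj) invfM.
Qed.

Lemma QF_comb (x y : rat) (a b : algC) : QF D a -> QF D b ->
  QF D (ratC x * a + ratC y * b).
Proof. by move=> Ka Kb; apply: QFD; apply: QFM => //; apply: QF_rat. Qed.

Lemma normK_comb (x y : rat) (a b : algC) : QF D a -> QF D b ->
  normK (ratC x * a + ratC y * b) = qform (normK a) (polarK a b) (normK b) x y.
Proof.
move=> Ka Kb; apply: ratC_inj; rewrite normKE; last exact: QF_comb.
rewrite conjC_comb.
transitivity (a * a^* * ratC x ^+ 2 + (a * b^* + b * a^*) * ratC x * ratC y
  + b * b^* * ratC y ^+ 2); first by ring.
by rewrite -(normKE Ka) -(normKE Kb) -(polarKE Ka Kb) /qform; ring.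
Qed.

(* Quantifies the triangle inequality without square roots, by
   [0 <= N(t u + v)] for a suitable rational [t]. *)
Lemma normK_perturb (n m : rat) : 0 < n -> n < m -> exists2 e : rat, 0 < e &
  forall u v : algC, QF D u -> QF D v -> m <= normK u -> normK v <= e ->
    n <= normK (u + v).
Proof.
move=> n_gt0 lt_nm; have m_gt0 := lt_trans n_gt0 lt_nm.
have [t [t_gt0 t_lt1 tm]] : exists t, [/\ 0 < t, t < 1 & 2 * t * m = m - n].
  exists ((m - n) / (2 * m)); split; last by field; rewrite gt_eqF.
    by rewrite divr_gt0 ?subr_gt0 ?mulr_gt0.
  by rewrite ltr_pdivrMr ?mulr_gt0 //; lra.
exists (t * t * m); first by rewrite !mulr_gt0.
move=> u v Ku Kv le_m_u le_v; rewrite -[u]mul1r -[v]mul1r -(rmorph1 ratC) normK_comb //.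
have := normK_ge0 (QF_comb t 1 Ku Kv); rewrite normK_comb // /qform.
move: (normK u) (polarK u v) (normK v) le_m_u le_v => U P V le_m_u le_v comb_ge0.
rewrite -(ler_pM2l t_gt0).
have le_U : t * (1 - t) * m <= t * (1 - t) * U.
  by rewrite ler_pM2l // mulr_gt0 // subr_gt0.
have le_V : (1 - t) * V <= (1 - t) * (t * t * m) by rewrite ler_pM2l // subr_gt0.
have nE : n = m - 2 * t * m by rewrite tm; ring.
have : 0 <= t * t * t * m by rewrite !mulr_ge0 // ltW.
by rewrite nE; lra.
Qed.
Lemma ratr_sqrtmD_eq0 (a b : rat) : ratC a + ratC b * s = 0 -> a = 0 /\ b = 0.
Proof.
move=> ab0; have : a ^+ 2 + D%:R * b ^+ 2 = 0.
  by apply: ratC_inj; rewrite -mul_conjC_QF ab0 mul0r rmorph0.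
have Db_ge0 : 0 <= D%:R * b ^+ 2 by rewrite mulr_ge0 ?ler0n ?sqr_ge0.
move/eqP; rewrite paddr_eq0 ?sqr_ge0 // sqrf_eq0 mulf_eq0 sqrf_eq0 pnatr_eq0.
by rewrite (gtn_eqF D_gt0) => /andP[/eqP-> /eqP->].
Qed.

(** * The ring of integers *)

Definition omega : algC := if (D %% 4 == 3)%N then (1 + s) / 2 else s.
Definition omega_tr : int := (D %% 4 == 3)%N.
Definition omega_nrm : int := if (D %% 4 == 3)%N then (D.+1 %/ 4)%N else D.
Definition absdisc : int := if (D %% 4 == 3)%N then D else (4 * D)%N.

Local Notation w := omega.

Lemma absdiscE : absdisc = 4 * omega_nrm - omega_tr ^+ 2.
Proof. by rewrite /absdisc /omega_nrm /omega_tr; case: eqP => ?; lia. Qed.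

Lemma absdisc_gt0 : 0 < absdisc.
Proof. by rewrite /absdisc; case: eqP => ?; lia. Qed.

Lemma omegaE : w = ratC (omega_tr%:~R / 2) + ratC ((2 - omega_tr)%:~R / 2) * s.
Proof. by rewrite /omega /omega_tr; case: eqP => _ /=; field. Qed.

Lemma absdisc_sqr : (2 - omega_tr) ^+ 2 * D = absdisc.
Proof. by rewrite /absdisc /omega_tr; case: eqP => _ /=; lia. Qed.

Lemma ratr_omega (a b : rat) :
  ratC a + ratC b * w
  = ratC (a + b * omega_tr%:~R / 2) + ratC (b * (2 - omega_tr)%:~R / 2) * s.
Proof. by rewrite omegaE; field. Qed.

Lemma QF_omega : QF D w.
Proof. by rewrite omegaE; do 2!eexists; reflexivity. Qed.

Lemma QF_omegaP (x : algC) : QF D x -> exists a b : rat, x = ratC a + ratC b * w.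
Proof.
move=> [a [b ->]]; have c_neq0 : (2 - omega_tr)%:~R != 0 :> rat.
  by rewrite intr_eq0 /omega_tr; lia.
exists (a - b * omega_tr%:~R / (2 - omega_tr)%:~R), (2 * b / (2 - omega_tr)%:~R).
rewrite ratr_omega; move: (2 - omega_tr)%:~R c_neq0 => c c_neq0.
by congr (ratC _ + ratC _ * _); field.
Qed.

Lemma conjC_omega : w^* = omega_tr%:~R - w.
Proof. by rewrite omegaE conjC_ratr_sqrtmD; field. Qed.

Lemma omega_sqr : w ^+ 2 = omega_tr%:~R * w - omega_nrm%:~R.
Proof.
apply: (mulfI (_ : 4 != 0)); first by rewrite pnatr_eq0.
transitivity (omega_tr%:~R ^+ 2 + 2 * omega_tr%:~R * (2 - omega_tr)%:~R * s
  + ((2 - omega_tr) ^+ 2)%:~R * s ^+ 2); first by rewrite omegaE; field.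
have -> : ((2 - omega_tr) ^+ 2)%:~R * s ^+ 2 = omega_tr%:~R ^+ 2 - 4 * omega_nrm%:~R.
  transitivity (- absdisc%:~R : algC); last by rewrite absdiscE; ring.
  by rewrite -absdisc_sqr sqrtmD_sqr; ring.
by rewrite omegaE; field.
Qed.

Lemma ratr_omega_eq0 (a b : rat) : ratC a + ratC b * w = 0 -> a = 0 /\ b = 0.
Proof.
rewrite ratr_omega => /ratr_sqrtmD_eq0[a0 b0].
have b_eq0 : b = 0 by move: b0; rewrite /omega_tr; case: eqP => _ /=; lra.
by split=> //; move: a0; rewrite b_eq0; lra.
Qed.

Lemma int_omega_inj (a b c d : int) :
  a%:~R + b%:~R * w = c%:~R + d%:~R * w -> a = c /\ b = d.
Proof.
move=> e; have [] := @ratr_omega_eq0 (a - c)%:~R (b - d)%:~R.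
  rewrite !ratr_int.
  transitivity (a%:~R + b%:~R * w - (c%:~R + d%:~R * w)); first by ring.
  by rewrite e subrr.
by move=> /eqP + /eqP; rewrite !intr_eq0 !subr_eq0 => /eqP + /eqP.
Qed.

Lemma normK_int_omega (x y : int) : normK (x%:~R + y%:~R * w)
  = (x ^+ 2 + omega_tr * x * y + omega_nrm * y ^+ 2)%:~R.
Proof.
have -> : x%:~R + y%:~R * w = ratC x%:~R * 1 + ratC y%:~R * w by rewrite !ratr_int mulr1.
have [K1 Kw] := (QF_int 1, QF_omega).
rewrite normK_comb // /qform -[1](rmorph1 ratC) normK_rat.
suff [-> ->] : polarK (ratC 1) w = omega_tr%:~R /\ normK w = omega_nrm%:~R by ring.
split; apply: ratC_inj; rewrite ratr_int.
  by rewrite rmorph1 polarKE // conjC_omega rmorph1; ring.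
by rewrite normKE // conjC_omega mulrBr -expr2 omega_sqr; ring.
Qed.

Lemma Aint_omega : w \in Aint.
Proof.
apply: (@root_monic_Aint (('X - omega_tr%:~R%:P) * 'X + omega_nrm%:~R%:P)).
- rewrite /root !hornerE; apply/eqP.
  transitivity (w ^+ 2 - omega_tr%:~R * w + omega_nrm%:~R); first by ring.
  by rewrite omega_sqr; ring.
- rewrite monicE lead_coefDl; first by rewrite -monicE monicMl ?monicX ?monicXsubC.
  by rewrite size_mulX ?polyXsubC_eq0 // size_XsubC ltnS (leq_trans (size_polyC_leq1 _)).
- apply/polyOverP => i; rewrite coefD coefMX coefB coefX !coefC.
  by do ![case: ifP => _]; rewrite ?rpredD ?rpredN ?rpred_nat ?rpred0 ?intr_int.
Qed.

Hypothesis D_sqfree : squarefree D.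

Lemma sqfree_mod4 : (D %% 4 != 0)%N.
Proof. exact: (D_sqfree (isT : prime 2)). Qed.

Lemma sqfree_rat_int (q : rat) : D%:R * q ^+ 2 \is a Num.int -> q \is a Num.int.
Proof.
case/intrP=> k Dq.
have eZ : D%:Z * numq q ^+ 2 = k * denq q ^+ 2.
  apply: (intr_inj (R := rat)); rewrite !(rmorphM, rmorphXn) /= -Dq numqE; ring.
have eN : (D * `|numq q| ^ 2 = `|k| * `|denq q| ^ 2)%N.
  by move/(congr1 absz): eZ; rewrite abszM abszX [in RHS]abszM abszX.
have den1 : `|denq q|%N = 1%N.
  apply/eqP; rewrite eqn_leq absz_gt0 denq_neq0 andbT leqNgt.
  apply/negP => den_gt1; have p_pr := pdiv_prime den_gt1.
  have /negP := D_sqfree p_pr; apply; have p_dvd := pdiv_dvd `|denq q|.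
  have copr : coprime (pdiv `|denq q| * pdiv `|denq q|) (`|numq q| ^ 2).
    rewrite mulnn coprimeXl // coprimeXr //.
    by apply: coprime_dvdl p_dvd _; rewrite coprime_sym; apply: coprime_num_den.
  by rewrite -(Gauss_dvdl _ copr) eN dvdn_mull // -mulnn dvdn_mul.
have -> : q = (numq q)%:~R by rewrite numqE -[denq q]gez0_abs ?den1 ?mulr1.
exact: intr_int.
Qed.

(* [m] and [n] are the trace and the norm of [(m + l * s) / 2]. *)
Lemma trace_norm_omega (m l n : int) : m ^+ 2 + D%:Z * l ^+ 2 = 4 * n ->
  exists u v : int, m = 2 * u + omega_tr * v /\ l = (2 - omega_tr) * v.
Proof.
have half k : exists i : int, k = 2 * i \/ k = 2 * i + 1 by exists (k %/ 2)%Z; lia.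
have [[m' mE] [l' lE]] := (half m, half l).
have D_mod4 := sqfree_mod4; have DE := divn_eq D 4; rewrite /omega_tr.
move: (D %/ 4)%N (D %% 4)%N (ltn_pmod D (isT : 0 < 4)%N) D_mod4 DE => k c c_lt c_neq0 ->.
case: eqP => [c3 | c_neq3] /=; case: mE => ->; case: lE => -> e; try (exfalso; lia).
- by exists (m' - l'), (2 * l'); lia.
- by exists (m' - l'), (2 * l' + 1); lia.
- by exists m', l'; lia.
Qed.

Lemma OK_omegaP (x : algC) : OK D x <-> exists u v : int, x = u%:~R + v%:~R * w.
Proof.
split=> [[[a [b ->]] xA]|[u [v ->]]]; last first.
  split; last by rewrite rpredD ?rpredM ?Aint_omega ?Aint_int.
  by apply: QFD; last apply: QFM QF_omega; apply: QF_int.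
have xcA : ratC a - ratC b * s \in Aint by rewrite -conjC_ratr_sqrtmD Aint_aut.
have [m mE] : exists m : int, 2 * a = m%:~R.
  apply: ratr_Aint.
  by have -> : ratC (2 * a) = ratC a + ratC b * s + (ratC a - ratC b * s);
    [ring | rewrite rpredD].
have [n nE] : exists n : int, a ^+ 2 + D%:R * b ^+ 2 = n%:~R.
  by apply: ratr_Aint; rewrite -mul_conjC_QF conjC_ratr_sqrtmD rpredM.
have normE : (2 * a) ^+ 2 + D%:R * (2 * b) ^+ 2 = (4 * n)%:~R.
  by rewrite rmorphM /= -nE; ring.
have /sqfree_rat_int/intrP[l lE] : D%:R * (2 * b) ^+ 2 \is a Num.int.
  rewrite -[X in X \is a _](addKr ((2 * a) ^+ 2)) normE mE.
  by rewrite rpredD ?rpredN ?rpredX ?intr_int.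
have [u [v [mu lv]]] :
    exists u v : int, m = 2 * u + omega_tr * v /\ l = (2 - omega_tr) * v.
  apply: (@trace_norm_omega m l n); apply: (intr_inj (R := rat)).
  by rewrite -normE mE lE; ring.
exists u, v; rewrite -[u%:~R]ratr_int -[v%:~R]ratr_int ratr_omega.
by congr (ratC _ + ratC _ * _); [move: mE | move: lE]; rewrite ?mu ?lv; lra.
Qed.
Lemma OK_QF (x : algC) : OK D x -> QF D x.
Proof. by case. Qed.

Lemma OK_int (m : int) : OK D m%:~R.
Proof. by split; [apply: QF_int | apply: Aint_int]. Qed.

Lemma OK0 : OK D 0. Proof. exact: (OK_int 0). Qed.

Lemma OK1 : OK D 1. Proof. exact: (OK_int 1). Qed.

Lemma OK_omega : OK D w.
Proof. by split; [apply: QF_omega | apply: Aint_omega]. Qed.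

Lemma OKD (x y : algC) : OK D x -> OK D y -> OK D (x + y).
Proof. by move=> [Kx Ax] [Ky Ay]; split; [apply: QFD | apply: rpredD]. Qed.

Lemma OKN (x : algC) : OK D x -> OK D (- x).
Proof. by move=> [Kx Ax]; split; [apply: QFN | rewrite rpredN]. Qed.

Lemma OKB (x y : algC) : OK D x -> OK D y -> OK D (x - y).
Proof. by move=> Ox /OKN; apply: OKD. Qed.

Lemma OKM (x y : algC) : OK D x -> OK D y -> OK D (x * y).
Proof. by move=> [Kx Ax] [Ky Ay]; split; [apply: QFM | apply: rpredM]. Qed.

Lemma OK_conj (x : algC) : OK D x -> OK D x^*.
Proof. by move=> [Kx Ax]; split; [apply: QF_conj | rewrite Aint_aut]. Qed.

Lemma OK_ratr (q : rat) : OK D (ratC q) -> exists m : int, q = m%:~R.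
Proof. by case=> _ /ratr_Aint. Qed.

Lemma normK_OK (x : algC) : OK D x -> exists n : nat, normK x = n%:R.
Proof.
move=> Ox; have [m mE] : exists m : int, normK x = m%:~R.
  by apply: OK_ratr; rewrite normKE; [apply/OKM/OK_conj | apply: OK_QF].
have := normK_ge0 (OK_QF Ox); rewrite mE ler0z => m_ge0.
by exists `|m|%N; rewrite -[in LHS](gez0_abs m_ge0).
Qed.

Lemma OK_denominator (x : algC) : QF D x -> exists m : int, m != 0 /\ OK D (m%:~R * x).
Proof.
case/QF_omegaP=> a [b ->]; exists (denq a * denq b); split.
  by rewrite mulf_neq0 ?denq_neq0.
have -> : (denq a * denq b)%:~R * (ratC a + ratC b * w)
    = ratC (denq b)%:~R * ratC (a * (denq a)%:~R)
      + ratC (denq a)%:~R * ratC (b * (denq b)%:~R) * w.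
  by rewrite -!(ratr_int algC); ring.
rewrite -!numqE !ratr_int.
by apply: OKD; last apply: OKM OK_omega; rewrite -rmorphM; apply: OK_int.
Qed.

(** * Ideals and their norms *)

Lemma prodset0 (I J : algC -> Prop) : prodset I J 0.
Proof. by exists 0, (fun=> 0), (fun=> 0); split=> [[]|[]|]; rewrite ?big_ord0. Qed.

Lemma prodsetM (I J : algC -> Prop) (x y : algC) : I x -> J y -> prodset I J (x * y).
Proof. by move=> Ix Jy; exists 1, (fun=> x), (fun=> y); rewrite big_ord1. Qed.

Lemma prodsetD (I J : algC -> Prop) (z z' : algC) :
  prodset I J z -> prodset I J z' -> prodset I J (z + z').
Proof.
move=> [n [a [b [Ia Jb ->]]]] [m [c [d [Ic Jd ->]]]].
exists (n + m)%N, (fun k => match split k with inl i => a i | inr i => c i end).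
exists (fun k => match split k with inl i => b i | inr i => d i end).
split; try by move=> k; case: split.
rewrite big_split_ord /=; congr (_ + _); apply: eq_bigr => i _.
  by rewrite (unsplitK (inl i)).
by rewrite (unsplitK (inr i)).
Qed.

Lemma prodset_ind (I J P : algC -> Prop) :
  P 0 -> (forall z z', P z -> P z' -> P (z + z')) ->
  (forall x y, I x -> J y -> P (x * y)) -> forall z, prodset I J z -> P z.
Proof.
move=> P0 PD PM z [n [a [b [Ia Jb ->]]]].
by apply: big_ind => // i _; apply: PM.
Qed.

Lemma prodset_mul_ind (I J I' J' : algC -> Prop) (c : algC) :
  (forall x y, I x -> J y -> prodset I' J' (c * (x * y))) ->
  forall z, prodset I J z -> prodset I' J' (c * z).
Proof.
move=> IJ; apply: prodset_ind => [|z z'|//]; first by rewrite mulr0; apply: prodset0.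
by rewrite mulrDr; apply: prodsetD.
Qed.

Section FracIdeal.
Variables (I : algC -> Prop) (fI : frac_ideal D I).

Lemma frac_ideal_QF (x : algC) : I x -> QF D x.
Proof. by case: fI => -[IK _ _ _ _] _; apply: IK. Qed.

Lemma frac_ideal0 : I 0.
Proof. by case: fI => -[]. Qed.

Lemma frac_idealD (x y : algC) : I x -> I y -> I (x + y).
Proof. by case: fI => -[_ _ _ ID _] _; apply: ID. Qed.

Lemma frac_idealM (c x : algC) : OK D c -> I x -> I (c * x).
Proof. by case: fI => -[_ _ _ _ IM] _; apply: IM. Qed.

Lemma frac_ideal_intM (m : int) (x : algC) : I x -> I (m%:~R * x).
Proof. exact/frac_idealM/OK_int. Qed.

Lemma frac_idealN (x : algC) : I x -> I (- x).
Proof. by rewrite -mulN1r; apply: (frac_ideal_intM (-1)). Qed.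

Lemma frac_idealB (x y : algC) : I x -> I y -> I (x - y).
Proof. by move=> Ix /frac_idealN; apply: frac_idealD. Qed.

Lemma frac_ideal_neq0 : exists x, I x /\ x != 0.
Proof. by case: fI => -[_ _ In0 _ _] _. Qed.

Lemma frac_ideal_denominator :
  exists d, [/\ OK D d, d != 0 & forall x, I x -> OK D (d * x)].
Proof. by case: fI. Qed.

End FracIdeal.

Lemma int_ideal_frac (C : algC -> Prop) : int_ideal D C -> frac_ideal D C.
Proof.
move=> [CO C0 Cn0 CD CM]; split; first by split=> // x /CO/OK_QF.
by exists 1; split=> [||x /CO]; rewrite ?oner_neq0 ?mul1r //; apply: OK1.
Qed.

Lemma int_ideal_OK : int_ideal D (OK D).
Proof.
split=> //; [exact: OK0 | | exact: OKD | exact: OKM].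
by exists 1; split; [exact: OK1 | exact: oner_neq0].
Qed.

Lemma frac_ideal_OK : frac_ideal D (OK D).
Proof. exact/int_ideal_frac/int_ideal_OK. Qed.

Lemma frac_ideal_scale (a : algC) (I : algC -> Prop) :
  QF D a -> a != 0 -> frac_ideal D I -> frac_ideal D (scaleset a I).
Proof.
move=> Ka a_neq0 fI; split.
  split.
  - by move=> _ [x [Ix ->]]; apply: QFM => //; apply: frac_ideal_QF Ix.
  - by exists 0; rewrite mulr0; split=> //; apply: frac_ideal0 fI.
  - have [x [Ix x_neq0]] := frac_ideal_neq0 fI.
    by exists (a * x); split; [exists x | rewrite mulf_neq0].
  - move=> _ _ [x [Ix ->]] [y [Iy ->]]; exists (x + y); rewrite mulrDr.
    by split=> //; apply: frac_idealD.
  - move=> c _ Oc [x [Ix ->]]; exists (c * x); rewrite mulrCA.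
    by split=> //; apply: frac_idealM.
have [d [Od d_neq0 dI]] := frac_ideal_denominator fI.
have [m [m_neq0 Om]] := OK_denominator Ka.
exists (m%:~R * d); split; first by apply: OKM; first apply: OK_int.
  by rewrite mulf_neq0 ?intr_eq0.
by move=> _ [x [Ix ->]]; rewrite mulrACA; apply: OKM => //; apply: dI.
Qed.

Lemma frac_ideal_prod (I J : algC -> Prop) :
  frac_ideal D I -> frac_ideal D J -> frac_ideal D (prodset I J).
Proof.
move=> fI fJ; split.
  split.
  - apply: prodset_ind => [||x y Ix Jy]; [exact: OK_QF OK0 | exact: QFD |].
    by apply: QFM; [apply: (frac_ideal_QF fI) | apply: (frac_ideal_QF fJ)].
  - exact: prodset0.
  - have [x [Ix x_neq0]] := frac_ideal_neq0 fI.
    have [y [Jy y_neq0]] := frac_ideal_neq0 fJ.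
    by exists (x * y); split; [apply: prodsetM | apply: mulf_neq0].
  - by move=> x y; apply: prodsetD.
  - move=> c z Oc; apply: prodset_mul_ind z => x y Ix Jy.
    by rewrite mulrA; apply: prodsetM => //; apply: frac_idealM.
have [d [Od d_neq0 dI]] := frac_ideal_denominator fI.
have [e [Oe e_neq0 eJ]] := frac_ideal_denominator fJ.
exists (d * e); split; [exact: OKM | exact: mulf_neq0 |].
apply: prodset_ind => [|z z'|x y Ix Jy]; first by rewrite mulr0; apply: OK0.
  by rewrite mulrDr; apply: OKD.
by rewrite mulrACA; apply: OKM; [apply: dI | apply: eJ].
Qed.

(* Says [I * conj I = r O]: as [1] is a combination of the [x y^* / r], it is
   enough to have [r] itself in the product. *)
Definition ideal_norm (I : algC -> Prop) (r : rat) : Prop :=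
  [/\ 0 < r, forall x y, I x -> I y -> OK D (x * y^* / ratC r)
    & prodset I (fun z => I z^*) (ratC r)].

Lemma ratC_neq0 (r : rat) : 0 < r -> ratC r != 0.
Proof. by move=> r_gt0; rewrite fmorph_eq0 gt_eqF. Qed.

Lemma ideal_norm_gt0 (I : algC -> Prop) (r : rat) : ideal_norm I r -> 0 < r.
Proof. by case. Qed.

Lemma ideal_norm_OK : ideal_norm (OK D) 1.
Proof.
split=> // [x y Ox Oy|].
  by rewrite rmorph1 divr1; apply: OKM => //; apply: OK_conj.
by rewrite rmorph1 -[1]mulr1; apply: prodsetM; rewrite ?conjC1; apply: OK1.
Qed.

Lemma ideal_norm_scale (a : algC) (I : algC -> Prop) (r : rat) : QF D a -> a != 0 ->
  ideal_norm I r -> ideal_norm (scaleset a I) (normK a * r).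
Proof.
move=> Ka a_neq0 [r_gt0 Ir rI]; have r_neq0 := ratC_neq0 r_gt0.
have ac_neq0 : a^* != 0 by rewrite conjC_eq0.
split; first by rewrite mulr_gt0 ?normK_gt0.
  move=> _ _ [x [Ix ->]] [y [Iy ->]]; have := Ir x y Ix Iy.
  congr (OK D _); rewrite (rmorphM ratC) (rmorphM Num.conj) /= normKE //.
  by field; apply/and3P.
rewrite (rmorphM ratC) /= normKE //; apply: prodset_mul_ind rI => x y Ix Iy.
rewrite mulrACA; apply: prodsetM; first by exists x.
by exists y^*; rewrite (rmorphM Num.conj) /= conjCK.
Qed.

Lemma ideal_norm_prod (I J : algC -> Prop) (r r' : rat) :
  ideal_norm I r -> ideal_norm J r' -> ideal_norm (prodset I J) (r * r').
Proof.
move=> [r_gt0 Ir rI] [r'_gt0 Jr rJ].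
split; first exact: mulr_gt0.
  move=> z z' IJz; rewrite (rmorphM ratC) /= invfM => IJz'; move: z IJz.
  apply: prodset_ind => [|z1 z2|x1 y1 Ix1 Jy1]; first by rewrite !mul0r; apply: OK0.
    by rewrite !mulrDl; apply: OKD.
  move: z' IJz'; apply: prodset_ind => [|z1 z2|x2 y2 Ix2 Jy2].
  - by rewrite rmorph0 mulr0 mul0r; apply: OK0.
  - by rewrite rmorphD mulrDr mulrDl; apply: OKD.
  have -> : x1 * y1 * (x2 * y2)^* * ((ratC r)^-1 * (ratC r')^-1)
      = x1 * x2^* / ratC r * (y1 * y2^* / ratC r') by rewrite (rmorphM Num.conj) /=; ring.
  by apply: OKM; [apply: Ir | apply: Jr].
rewrite (rmorphM ratC) /= mulrC; apply: prodset_mul_ind rI => x1 x2 Ix1 Ix2.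
rewrite mulrC; apply: prodset_mul_ind rJ => y1 y2 Jy1 Jy2.
by rewrite mulrACA; apply: prodsetM; [apply: prodsetM | rewrite rmorphM; apply: prodsetM].
Qed.

Lemma ideal_norm_ratio (I : algC -> Prop) (r r' : rat) :
  ideal_norm I r -> ideal_norm I r' -> exists m : int, r / r' = m%:~R.
Proof.
move=> [_ _ rI] [_ Ir' _]; apply: OK_ratr; rewrite (fmorph_div ratC) /=.
move: (ratC r) rI; apply: prodset_ind => [|z z'|x y Ix Iy].
- by rewrite mul0r; apply: OK0.
- by rewrite mulrDl; apply: OKD.
- by have := Ir' _ _ Ix Iy; rewrite conjCK.
Qed.

Lemma ideal_norm_unique (I : algC -> Prop) (r r' : rat) :
  ideal_norm I r -> ideal_norm I r' -> r = r'.
Proof.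
move=> nr nr'; have [r_gt0 r'_gt0] := (ideal_norm_gt0 nr, ideal_norm_gt0 nr').
have [m mE] := ideal_norm_ratio nr nr'; have [n nE] := ideal_norm_ratio nr' nr.
have m_gt0 : 0 < m by rewrite -(ltr0z rat) -mE divr_gt0.
have n_gt0 : 0 < n by rewrite -(ltr0z rat) -nE divr_gt0.
have mn1 : m * n = 1.
  apply: (intr_inj (R := rat)); rewrite rmorphM /= -mE -nE.
  by field; rewrite !gt_eqF.
by apply/divr1_eq; rewrite mE; have -> : m = 1 by nia.
Qed.

Lemma finvE (I : algC -> Prop) (r : rat) (z : algC) :
  frac_ideal D I -> ideal_norm I r -> QF D z -> Defs.finv D I z <-> I (ratC r * z^*).
Proof.
move=> fI [r_gt0 Ir rI] Kz; have r_neq0 := ratC_neq0 r_gt0; split=> [[_ zI]|Iz].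
  rewrite -conjCM_ratr; move: (ratC r) rI; apply: prodset_ind => [|x x'|x y Ix Iy].
  - by rewrite mul0r rmorph0; apply: frac_ideal0 fI.
  - by rewrite mulrDl rmorphD; apply: frac_idealD.
  - have -> : x * y * z = z * x * y by ring.
    by rewrite rmorphM; apply: frac_idealM => //; apply/OK_conj/zI.
split=> // x Ix; have := Ir _ _ Ix Iz; rewrite conjCM_ratr conjCK.
by congr (OK D _); field.
Qed.

Lemma ideal_norm_finv (I : algC -> Prop) (r : rat) :
  frac_ideal D I -> ideal_norm I r -> ideal_norm (Defs.finv D I) r^-1.
Proof.
move=> fI nI; have [r_gt0 Ir rI] := nI; have r_neq0 := ratC_neq0 r_gt0.
have finvP z : QF D z -> Defs.finv D I z <-> I (ratC r * z^*) := finvE fI nI.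
split; first by rewrite invr_gt0.
  move=> x y fx fy; have [Kx _] := fx; have [Ky _] := fy.
  have := Ir _ _ ((finvP y Ky).1 fy) ((finvP x Kx).1 fx).
  by rewrite conjCM_ratr conjCK fmorphV; congr (OK D _) => /=; field.
have -> : ratC r^-1 = ratC (r^-1 ^+ 2) * ratC r by rewrite fmorphV /=; field.
apply: prodset_mul_ind rI => x y Ix Iy.
have Kr := QF_rat r^-1.
have rV : ratC r * ratC r^-1 = 1.
  by rewrite -(rmorphM ratC) divff ?gt_eqF ?(rmorph1 ratC).
have -> : ratC (r^-1 ^+ 2) * (x * y) = (ratC r^-1 * y) * (ratC r^-1 * x) by ring.
have Ky : QF D y by rewrite -[y]conjCK; apply/QF_conj/(frac_ideal_QF fI).
have Kx := frac_ideal_QF fI Ix.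
apply: prodsetM; apply/finvP; rewrite ?conjCM_ratr.
- exact: QFM.
- by rewrite mulrA rV mul1r.
- by apply: QFM => //; apply: QF_conj.
- by rewrite mulrA rV mul1r conjCK.
Qed.

(** * Norm forms *)

Lemma absdisc_fundamental (p : nat) (m : int) : prime p ->
  (m %% 4)%Z = 0 \/ (m %% 4)%Z = 3 -> absdisc <> m * (p * p)%N%:Z.
Proof.
move=> p_pr m_mod4 discE; have /negP := D_sqfree p_pr; apply.
have D_mod4 := sqfree_mod4; move: discE; rewrite /absdisc.
case: eqP => D_mod4E discE.
  suff : ((p * p)%N%:Z %| D%:Z)%Z by [].
  by rewrite discE dvdz_mull.
have pp_dvd : (p * p %| 4 * D)%N.
  suff : ((p * p)%N%:Z %| (4 * D)%N%:Z)%Z by [].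
  by rewrite discE dvdz_mull.
have [p2|p_odd] := even_prime p_pr.
  by move: discE; rewrite p2 => discE; exfalso; lia.
move: pp_dvd; rewrite Gauss_dvdr // -[4%N]/(2 ^ 2)%N mulnn coprimeXl // coprimeXr //.
by rewrite coprimen2.
Qed.

Lemma qform_primitive (A B C : int) : qform_absdisc A B C = absdisc ->
  exists u v t : int, u * A + v * B + t * C = 1.
Proof.
rewrite /qform_absdisc => discE; have [u [v uv]] := Bezoutz A B.
have [k [t kt]] := Bezoutz (gcdz A B) C.
suff g1 : gcdz (gcdz A B) C = 1.
  by exists (k * u), (k * v), t; rewrite -g1 -kt -uv; ring.
have gC := dvdz_gcdr (gcdz A B) C; have gAB := dvdz_gcdl (gcdz A B) C.
have gA := dvdz_trans gAB (dvdz_gcdl A B); have gB := dvdz_trans gAB (dvdz_gcdr A B).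
have g_ge0 : 0 <= gcdz (gcdz A B) C by [].
move: (gcdz (gcdz A B) C) g_ge0 gA gB gC {k t kt gAB u v uv}; case=> // g _ gA gB gC.
have g_gt0 : (0 < g)%N.
  rewrite lt0n; apply/eqP => g0.
  move: gA gB gC; rewrite g0 !dvd0z => /eqP A0 /eqP B0 /eqP C0.
  by have := absdisc_gt0; rewrite -discE A0 B0 C0.
have [g_gt1|] := ltnP 1 g; last by case: (g) g_gt0 => [|[]].
have p_dvd : ((pdiv g)%:Z %| g%:Z)%Z by apply: pdiv_dvd.
have [A' AE] := dvdzP (dvdz_trans p_dvd gA).
have [B' BE] := dvdzP (dvdz_trans p_dvd gB).
have [C' CE] := dvdzP (dvdz_trans p_dvd gC).
case: (@absdisc_fundamental (pdiv g) (4 * A' * C' - B' ^+ 2)); first exact: pdiv_prime.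
  have [i [BE'|BE']] : exists i : int, B' = 2 * i \/ B' = 2 * i + 1.
    by exists (B' %/ 2)%Z; lia.
  - by left; rewrite BE'; lia.
  - by right; rewrite BE'; lia.
by rewrite -discE AE BE CE PoszM; ring.
Qed.

Definition zbasis (I : algC -> Prop) (a b : algC) : Prop :=
  forall z, I z <-> exists x y : int, z = x%:~R * a + y%:~R * b.

Lemma zbasisl (I : algC -> Prop) (a b : algC) : zbasis I a b -> I a.
Proof. by move=> bI; apply/bI; exists 1, 0; rewrite mul1r mul0r addr0. Qed.

Lemma zbasis_swap (I : algC -> Prop) (a b : algC) : zbasis I a b -> zbasis I b a.
Proof.
move=> bI z; split=> [/bI[x [y ->]]|[x [y ->]]]; [|apply/bI].
  by exists y, x; rewrite addrC.
by exists y, x; rewrite addrC.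
Qed.

Lemma zbasisr (I : algC -> Prop) (a b : algC) : zbasis I a b -> I b.
Proof. by move=> bI; apply: zbasisl (zbasis_swap bI). Qed.

Lemma zbasis_subr (I : algC -> Prop) (a b : algC) (m : int) :
  zbasis I a b -> zbasis I a (m%:~R * a - b).
Proof.
move=> bI z; split=> [/bI[x [y ->]]|[x [y ->]]]; [|apply/bI];
  exists (x + m * y), (- y); ring.
Qed.

Lemma zbasisN (I : algC -> Prop) (a b : algC) : zbasis I a b -> zbasis I a (- b).
Proof. by move=> bI; have := zbasis_subr 0 bI; rewrite mul0r sub0r. Qed.

Definition norm_form (I : algC -> Prop) (a b : algC) (r : rat) (A B C : int) : Prop :=
  [/\ zbasis I a b, ideal_norm I r, qform_absdisc A B C = absdisc
    & forall x y : rat, normK (ratC x * a + ratC y * b)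
      = r * qform A%:~R B%:~R C%:~R x y].

Lemma gram_norm_form (I : algC -> Prop) (a b g : algC) (r : rat) (A B C : int) :
    frac_ideal D I -> zbasis I a b -> 0 < r -> OK D g ->
    a * a^* = ratC r * A%:~R -> a * b^* = ratC r * g -> g + g^* = B%:~R ->
    b * b^* = ratC r * C%:~R -> qform_absdisc A B C = absdisc ->
  norm_form I a b r A B C.
Proof.
move=> fI bI r_gt0 Og aa ab gB bb discE; have r_neq0 := ratC_neq0 r_gt0.
have [Ia Ib] := (zbasisl bI, zbasisr bI).
have [Ka Kb] := (frac_ideal_QF fI Ia, frac_ideal_QF fI Ib).
have ba : b * a^* = ratC r * g^*.
  by rewrite -conjCM_ratr -ab (rmorphM Num.conj) /= conjCK mulrC.
split=> // [|x y]; last first.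
  rewrite normK_comb // /qform.
  have -> : normK a = r * A%:~R.
    by apply: ratC_inj; rewrite normKE // aa -(ratr_int algC) rmorphM.
  have -> : normK b = r * C%:~R.
    by apply: ratC_inj; rewrite normKE // bb -(ratr_int algC) rmorphM.
  have -> : polarK a b = r * B%:~R.
    by apply: ratC_inj; rewrite polarKE // ab ba -mulrDr gB -(ratr_int algC) rmorphM.
  by ring.
split=> // [_ _ /bI[x [y ->]] /bI[x' [y' ->]]|].
  have -> : (x%:~R * a + y%:~R * b) * (x'%:~R * a + y'%:~R * b)^* / ratC r
    = (x * x')%:~R * A%:~R + (x * y')%:~R * g + (y * x')%:~R * g^* + (y * y')%:~R * C%:~R.
    rewrite -[x'%:~R]ratr_int -[y'%:~R]ratr_int conjC_comb !ratr_int.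
    transitivity (((x * x')%:~R * (a * a^*) + (x * y')%:~R * (a * b^*)
      + (y * x')%:~R * (b * a^*) + (y * y')%:~R * (b * b^*)) / ratC r); first by ring.
    by rewrite aa ab ba bb; field.
  by do ![apply: OKD | apply: OKM | apply: OK_int | exact: Og | apply: OK_conj].
have [u [v [t bezout]]] := qform_primitive discE.
have -> : ratC r = (u%:~R * a) * a^* + (v%:~R * a) * b^* + (v%:~R * b) * a^*
    + (t%:~R * b) * b^*.
  transitivity (ratC r * (u * A + v * B + t * C)%:~R); first by rewrite bezout mulr1.
  transitivity (u%:~R * (ratC r * A%:~R) + v%:~R * (ratC r * (g + g^*))
    + t%:~R * (ratC r * C%:~R)).
    by rewrite gB; ring.
  by rewrite -aa -bb mulrDr -ab -ba; ring.
by do !apply: prodsetD; apply: prodsetM; rewrite ?conjCK //; apply: frac_ideal_intM.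
Qed.

Lemma omega_mul_matrix (a b : algC) (p q p' q' : int) : a != 0 ->
    w * a = p%:~R * a + q%:~R * b -> w * b = p'%:~R * a + q'%:~R * b ->
  omega_tr = p + q' /\ omega_nrm = p * q' - q * p'.
Proof.
move=> a_neq0 wa wb.
have [/eqP nE tE] : - omega_nrm = q * p' - p * q' /\ omega_tr = p + q'.
  apply: int_omega_inj; apply: (mulIf a_neq0).
  transitivity (w ^+ 2 * a); first by rewrite omega_sqr; ring.
  have qb : q%:~R * b = w * a - p%:~R * a by rewrite wa; ring.
  transitivity (p%:~R * (w * a) + q%:~R * (w * b)).
    by rewrite expr2 -mulrA {1}wa; ring.
  transitivity (p%:~R * (w * a) + q%:~R * p'%:~R * a + q'%:~R * (q%:~R * b)).
    by rewrite wb; ring.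
  by rewrite qb; ring.
by split=> //; lia.
Qed.

(* The form is read off [b / a = (w - p) / q]. *)
Lemma omega_matrix_norm_form (I : algC -> Prop) (a b : algC) (p q p' q' : int) :
    frac_ideal D I -> zbasis I a b -> a != 0 ->
    w * a = p%:~R * a + q%:~R * b -> w * b = p'%:~R * a + q'%:~R * b -> 0 < q ->
  norm_form I a b (normK a / q%:~R) q (q' - p) (- p').
Proof.
move=> fI bI a_neq0 wa wb q_gt0; have Ka := frac_ideal_QF fI (zbasisl bI).
have [tE nE] := omega_mul_matrix a_neq0 wa wb.
have q_neq0 : q%:~R != 0 :> algC by rewrite intr_eq0 gt_eqF.
have r_gt0 : 0 < normK a / q%:~R by rewrite divr_gt0 ?normK_gt0 ?ltr0z.
have aa : a * a^* = ratC (normK a / q%:~R) * q%:~R.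
  by rewrite -normKE // -(ratr_int algC q) -(rmorphM ratC) divfK // intr_eq0 gt_eqF.
move: (normK a / q%:~R) r_gt0 aa => r r_gt0 aa.
have qb : q%:~R * b = (w - p%:~R) * a by rewrite mulrBl wa; ring.
have ba : b * a^* = ratC r * (w - p%:~R).
  apply: (mulfI q_neq0); transitivity ((w - p%:~R) * (a * a^*)); last by rewrite aa; ring.
  by rewrite [LHS]mulrA qb -mulrA.
have gc : (q'%:~R - w)^* = w - p%:~R.
  by rewrite rmorphB rmorph_int /= conjC_omega tE; ring.
have ab : a * b^* = ratC r * (q'%:~R - w).
  by rewrite -[LHS]conjCK (rmorphM Num.conj) /= conjCK mulrC ba conjCM_ratr -gc conjCK.
apply: (@gram_norm_form _ _ _ (q'%:~R - w)) => //.
- by apply: OKB OK_omega; apply: OK_int.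
- by rewrite gc; ring.
- apply: (mulfI q_neq0); transitivity ((w - p%:~R) * (a * b^*)).
    by rewrite [LHS]mulrA qb -mulrA.
  rewrite ab.
  transitivity (ratC r * ((p + q')%:~R * w - w ^+ 2 - (p * q')%:~R)); first by ring.
  by rewrite -tE omega_sqr nE; ring.
- by rewrite /qform_absdisc absdiscE tE nE; ring.
Qed.

Lemma zbasis_neq0 (I : algC -> Prop) (a b : algC) :
  frac_ideal D I -> zbasis I a b -> a != 0.
Proof.
move=> fI bI; apply/eqP => a0.
have b_neq0 : b != 0.
  apply/eqP => b0; have [x [/bI[m [n ->]]]] := frac_ideal_neq0 fI.
  by rewrite a0 b0 !mulr0 addr0 eqxx.
have /bI[m [n wb]] := frac_idealM fI OK_omega (zbasisr bI).
case: (@int_omega_inj n 0 0 1) => //; apply: (mulIf b_neq0).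
by transitivity (w * b); [rewrite wb a0; ring | ring].
Qed.

Lemma norm_formN (I : algC -> Prop) (a b : algC) (r : rat) (A B C : int) :
  norm_form I a b r A B C -> norm_form I a (- b) r A (- B) C.
Proof.
case=> bI nI discE normE; split=> //.
- exact: zbasisN.
- by rewrite -discE /qform_absdisc sqrrN.
move=> x y; transitivity (r * qform A%:~R B%:~R C%:~R x (- y)).
  by rewrite -normE; congr normK; ring.
by rewrite /qform; ring.
Qed.

Lemma zbasis_norm_form (I : algC -> Prop) (a b : algC) :
  frac_ideal D I -> zbasis I a b -> exists r A B C, norm_form I a b r A B C.
Proof.
move=> fI bI; have a_neq0 := zbasis_neq0 fI bI.
have /bI[p [q wa]] := frac_idealM fI OK_omega (zbasisl bI).
have /bI[p' [q' wb]] := frac_idealM fI OK_omega (zbasisr bI).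
have [q_lt0|q_gt0|q0] := ltgtP q 0; last 1 first.
- case: (@int_omega_inj 0 1 p 0) => //; apply: (mulIf a_neq0).
  by transitivity (w * a); [ring | rewrite wa q0; ring].
- have wa' : w * a = p%:~R * a + (- q)%:~R * - b by rewrite wa; ring.
  have wb' : w * - b = (- p')%:~R * a + q'%:~R * - b by rewrite mulrN wb; ring.
  rewrite -[b]opprK; do 4!eexists; apply: norm_formN.
  by apply: omega_matrix_norm_form wa' wb' _; rewrite ?oppr_gt0 //; apply: zbasisN.
- by do 4!eexists; apply: omega_matrix_norm_form wa wb q_gt0.
Qed.

Lemma norm_form_gram (I : algC -> Prop) (a b : algC) (r : rat) (A B C : int) :
  norm_form I a b r A B C ->
  [/\ normK a = r * A%:~R, polarK a b = r * B%:~R & normK b = r * C%:~R].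
Proof.
case=> _ _ _ normE.
have norm_a : normK a = r * A%:~R.
  by have := normE 1 0; rewrite /qform rmorph1 rmorph0 mul1r mul0r addr0 => ->; ring.
have norm_b : normK b = r * C%:~R.
  by have := normE 0 1; rewrite /qform rmorph1 rmorph0 mul1r mul0r add0r => ->; ring.
split=> //; rewrite /polarK norm_a norm_b.
by have := normE 1 1; rewrite /qform rmorph1 !mul1r => ->; ring.
Qed.

(** * Reduced bases *)

Definition rat_multiple (a b : algC) : Prop := exists q : rat, b = ratC q * a.

Lemma QF_span (a b z : algC) :
  QF D a -> QF D b -> a != 0 -> ~ rat_multiple a b -> QF D z ->
  exists x y : rat, z = ratC x * a + ratC y * b.
Proof.
move=> Ka Kb a_neq0 b_nmul Kz; have KVa := QFV Ka.
have [p [q bE]] := QFM Kb KVa; have [u [v zE]] := QFM Kz KVa.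
have q_neq0 : q != 0.
  apply/eqP => q0; apply: b_nmul; exists p.
  by rewrite -[LHS](divfK a_neq0) bE q0 rmorph0 mul0r addr0.
have qC_neq0 : ratC q != 0 by rewrite fmorph_eq0.
exists (u - v / q * p), (v / q).
rewrite -[z](divfK a_neq0) zE -[X in _ + _ * X](divfK a_neq0) bE.
by rewrite (rmorphB ratC) (rmorphM ratC) (fmorph_div ratC) /=; field.
Qed.

Lemma omega_not_rat_multiple (a : algC) : a != 0 -> ~ rat_multiple a (w * a).
Proof.
move=> a_neq0 [q /(mulIf a_neq0) wq].
have [] := @ratr_omega_eq0 (- q) 1; last by move=> _ /eqP.
by rewrite wq rmorphN rmorph1 mul1r addNr.
Qed.

Lemma frac_ideal_min_norm (I P : algC -> Prop) : frac_ideal D I ->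
    (forall z, P z -> I z) -> (exists z, P z) ->
  exists2 z, P z & forall y, P y -> normK z <= normK y.
Proof.
move=> fI PI [z0 Pz0]; have [d [Od d_neq0 dI]] := frac_ideal_denominator fI.
have norm_dM z : P z -> normK (d * z) = normK d * normK z.
  by move/PI/(frac_ideal_QF fI); apply: normKM; apply: OK_QF.
have norm_nat z : P z -> exists n : nat, normK (d * z) = n%:R.
  by move/PI/dI/normK_OK.
have [|n [z Pz zn] n_min] := @ex_minimal (fun n => exists2 z, P z & normK (d * z) = n%:R).
  by have [n nE] := norm_nat _ Pz0; exists n, z0.
exists z => // y Py; have [m mE] := norm_nat _ Py.
rewrite -(ler_pM2l (_ : 0 < normK d)) ?normK_gt0 //; last exact: OK_QF.
by rewrite -!norm_dM // zn mE ler_nat; apply: n_min; exists y.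
Qed.

Definition minimal_pair (I : algC -> Prop) (a b : algC) : Prop :=
  [/\ I a /\ a != 0, I b /\ ~ rat_multiple a b,
      forall z, I z -> z != 0 -> normK a <= normK z
    & forall z, I z -> ~ rat_multiple a z -> normK b <= normK z].

Lemma minimal_pair_exists (I : algC -> Prop) : frac_ideal D I ->
  exists a b, minimal_pair I a b /\ 0 <= polarK a b.
Proof.
move=> fI.
have [||a [Ia a_neq0] a_min] := @frac_ideal_min_norm I (fun z => I z /\ z != 0) fI.
- by move=> z [].
- exact: frac_ideal_neq0 fI.
have [||b [Ib b_nmul] b_min] :=
  @frac_ideal_min_norm I (fun z => I z /\ ~ rat_multiple a z) fI.
- by move=> z [].
- exists (w * a); split; first exact: frac_idealM OK_omega Ia.
  exact: omega_not_rat_multiple.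
have [Ka Kb] := (frac_ideal_QF fI Ia, frac_ideal_QF fI Ib).
have [polar_ge0|polar_lt0] := leP 0 (polarK a b).
  by exists a, b; split=> //; split=> // z Iz z_P; [apply: a_min | apply: b_min].
exists a, (- b); split; last first.
  have -> : polarK a (- b) = - polarK a b.
    by apply: ratC_inj; rewrite (rmorphN ratC) /= !polarKE ?rmorphN //;
      [ring | apply: QFN].
  by rewrite oppr_ge0 ltW.
split=> //; first 1 last.
- by move=> z Iz z_neq0; apply: a_min.
- by move=> z Iz z_nmul; rewrite normKN; apply: b_min.
split; first exact: frac_idealN.
by case=> q bE; apply: b_nmul; exists (- q); rewrite rmorphN mulNr -bE opprK.
Qed.

Lemma minimal_pair_reduced (I : algC -> Prop) (a b : algC) :
  frac_ideal D I -> minimal_pair I a b -> 0 <= polarK a b ->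
  qform_reduced (normK a) (polarK a b) (normK b).
Proof.
move=> fI [[Ia a_neq0] [Ib b_nmul] a_min b_min] polar_ge0.
have [Ka Kb] := (frac_ideal_QF fI Ia, frac_ideal_QF fI Ib).
apply/and4P; split=> //; first by rewrite normK_gt0.
  have : normK b <= normK (ratC (-1) * a + ratC 1 * b).
    have -> : ratC (-1) * a + ratC 1 * b = b - a by rewrite rmorphN rmorph1; ring.
    apply: b_min; first exact: frac_idealB.
    case=> q baE; apply: b_nmul; exists (q + 1).
    by rewrite rmorphD rmorph1 mulrDl -baE; ring.
  by rewrite normK_comb // /qform; lra.
apply: a_min => //; apply/eqP => b0; apply: b_nmul; exists 0.
by rewrite b0 rmorph0 mul0r.
Qed.

(* Moving [z] by the lattice makes its norm smaller than [normK b], so that it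
   becomes a multiple of [a], and then smaller than [normK a]. *)
Lemma minimal_pair_zbasis (I : algC -> Prop) (a b : algC) :
  frac_ideal D I -> minimal_pair I a b -> 0 <= polarK a b -> zbasis I a b.
Proof.
move=> fI ab_min polar_ge0; have redQ := minimal_pair_reduced fI ab_min polar_ge0.
have [[Ia a_neq0] [Ib b_nmul] a_min b_min] := ab_min.
have [Ka Kb] := (frac_ideal_QF fI Ia, frac_ideal_QF fI Ib).
have Icomb (i j : int) : I (i%:~R * a + j%:~R * b).
  by apply: frac_idealD => //; apply: frac_ideal_intM.
move=> z; split=> [Iz|[i [j ->]] //].
have [x [y zE]] := QF_span Ka Kb a_neq0 b_nmul (frac_ideal_QF fI Iz).
have [|i [j le_rho]] := qform_cover x y _ (qform_reduced_absdisc_gt0 redQ).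
  by case/and4P: redQ.
have Iz' := frac_idealB fI Iz (Icomb i j).
have [q zq] : rat_multiple a (z - (i%:~R * a + j%:~R * b)).
  apply: contrapT => z_nmul; have := b_min _ Iz' z_nmul; rewrite leNgt => /negP; apply.
  by rewrite zE comb_sub_int normK_comb // (le_lt_trans le_rho) // qform_sqradius_lt.
have Iza : I (z - (i%:~R * a + j%:~R * b) - (Num.floor q)%:~R * a).
  by apply: frac_idealB => //; apply: frac_ideal_intM.
exists (i + Num.floor q), j; apply/eqP; rewrite -subr_eq0.
have -> : z - ((i + Num.floor q)%:~R * a + j%:~R * b)
    = z - (i%:~R * a + j%:~R * b) - (Num.floor q)%:~R * a by ring.
apply/negPn/negP => /(a_min _ Iza); rewrite leNgt => /negP; apply.
rewrite zq -(ratr_int algC) -mulrBl -(rmorphB ratC) normKM ?normK_rat //;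
  last exact: QF_rat.
rewrite gtr_pMl ?normK_gt0 //; have := floor_itv q; rewrite rmorphD /= => ?; nra.
Qed.

Lemma reduced_norm_form_exists (I : algC -> Prop) : frac_ideal D I ->
  exists a b r A B C, norm_form I a b r A B C /\ qform_reduced A B C.
Proof.
move=> fI; have [a [b [ab_min polar_ge0]]] := minimal_pair_exists fI.
have bI := minimal_pair_zbasis fI ab_min polar_ge0.
have [r [A [B [C nf]]]] := zbasis_norm_form fI bI.
exists a, b, r, A, B, C; split=> //.
have := minimal_pair_reduced fI ab_min polar_ge0.
have [_ /ideal_norm_gt0 r_gt0 _ _] := nf; have [-> -> ->] := norm_form_gram nf.
by rewrite qform_reducedZ // qform_reduced_int.
Qed.

Lemma ideal_norm_exists (I : algC -> Prop) : frac_ideal D I -> exists r, ideal_norm I r.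
Proof.
by case/reduced_norm_form_exists=> a [b [r [A [B [C [[_ nI _ _] _]]]]]]; exists r.
Qed.

Local Notation sqradius A B C := (qform_sqradius (A%:~R : rat) B%:~R C%:~R).

Lemma zbasis_not_rat_multiple (I : algC -> Prop) (a b : algC) :
  frac_ideal D I -> zbasis I a b -> ~ rat_multiple a b.
Proof.
move=> fI bI [q bE]; have /bI[m [n wa]] := frac_idealM fI OK_omega (zbasisl bI).
apply: (omega_not_rat_multiple (zbasis_neq0 fI bI)); exists (m%:~R + n%:~R * q).
by rewrite wa bE (rmorphD ratC) (rmorphM ratC) /= !ratr_int; ring.
Qed.

Lemma norm_form_cover (I : algC -> Prop) (a b : algC) (r : rat) (A B C : int) (z : algC) :
  frac_ideal D I -> norm_form I a b r A B C -> 0 < A -> QF D z ->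
  exists2 c, I c & normK (z - c) <= r * sqradius A B C.
Proof.
move=> fI [bI nI discE normE] A_gt0 Kz; have r_gt0 := ideal_norm_gt0 nI.
have [Ia Ib] := (zbasisl bI, zbasisr bI).
have [Ka Kb] := (frac_ideal_QF fI Ia, frac_ideal_QF fI Ib).
have [x [y ->]] := QF_span Ka Kb (zbasis_neq0 fI bI) (zbasis_not_rat_multiple fI bI) Kz.
have [||i [j le_rho]] := @qform_cover rat A%:~R B%:~R C%:~R x y; first by rewrite ltr0z.
  by rewrite qform_absdisc_int discE ltr0z absdisc_gt0.
exists (i%:~R * a + j%:~R * b); first by apply/bI; exists i, j.
by rewrite comb_sub_int normE ler_pM2l.
Qed.

Lemma norm_form_hole (I : algC -> Prop) (a b : algC) (r : rat) (A B C : int) :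
  frac_ideal D I -> norm_form I a b r A B C -> qform_reduced A B C ->
  exists2 h, QF D h & forall c, I c -> r * sqradius A B C <= normK (h - c).
Proof.
move=> fI [bI nI _ normE]; rewrite -(qform_reduced_int rat) => /qform_hole[x [y hole]].
have [Ka Kb] := (frac_ideal_QF fI (zbasisl bI), frac_ideal_QF fI (zbasisr bI)).
exists (ratC x * a + ratC y * b); first exact: QF_comb.
move=> _ /bI[i [j ->]].
by rewrite comb_sub_int normE ler_pM2l // (ideal_norm_gt0 nI).
Qed.

(** * Index and norm *)

Lemma ideal_index_unique (J : algC -> Prop) (m n : nat) :
  (forall x y, J x -> J y -> J (x - y)) ->
  ideal_index D J m -> ideal_index D J n -> m = n.
Proof.
move=> JB.
have leq_index m1 m2 : ideal_index D J m1 -> ideal_index D J m2 -> (m1 <= m2)%N.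
  move=> [r [Or rJ _]] [r' [_ _ r'J]].
  have /fin_all_exists[f fJ] i : exists j, J (r i - r' j) by apply: r'J.
  rewrite -(card_ord m1) -(card_ord m2); apply: (leq_card f) => i j fij; apply: rJ.
  have -> : r i - r j = (r i - r' (f i)) - (r j - r' (f j)) by rewrite fij; ring.
  exact: JB.
by move=> im jn; apply/eqP; rewrite eqn_leq !leq_index.
Qed.

Lemma int_ideal_hermite_basis (J : algC -> Prop) : int_ideal D J ->
  exists (a k : nat) (b : int),
    [/\ (0 < a)%N, (0 < k)%N & zbasis J a%:R (b%:~R + k%:R * w)].
Proof.
move=> iJ; have fJ := int_ideal_frac iJ; have [JO _ [x [Jx x_neq0]] _ _] := iJ.
have [n nE] := normK_OK (JO _ Jx).
have Jn : J n%:~R.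
  have -> : n%:~R = x^* * x by rewrite mulrC -(normKE (OK_QF (JO _ Jx))) nE rmorph_nat.
  by apply: frac_idealM => //; apply/OK_conj/JO.
have n_neq0 : n%:Z != 0.
  by rewrite eqz_nat -(pnatr_eq0 rat) -nE gt_eqF // normK_gt0 //; apply/OK_QF/JO.
have [||a a_gt0 aP] := @int_subgroup_cyclic (fun m : int => J m%:~R).
- by move=> m m' Jm Jm'; rewrite rmorphB; apply: frac_idealB.
- by exists n.
have [||k k_gt0 kP] :=
  @int_subgroup_cyclic (fun v => exists u : int, J (u%:~R + v%:~R * w)).
- move=> v v' [u Ju] [u' Ju']; exists (u - u').
  have -> : (u - u')%:~R + (v - v')%:~R * w
      = u%:~R + v%:~R * w - (u'%:~R + v'%:~R * w) by ring.
  exact: frac_idealB.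
- exists n; split=> //; exists 0; rewrite add0r mulrC.
  exact: frac_idealM OK_omega Jn.
have Ja : J a%:R by apply/(aP a).
have [b Jb] : exists b : int, J (b%:~R + k%:R * w) by apply/(kP k).
exists a, k, b; split=> // z; split=> [Jz|[i [j ->]]]; last first.
  by apply: frac_idealD => //; apply: frac_ideal_intM.
have /OK_omegaP[u [v zE]] := JO _ Jz.
have /dvdzP[j vE] : (k %| v)%Z by apply/kP; exists u; rewrite -zE.
have /dvdzP[i uE] : (a %| u - j * b)%Z.
  apply/aP; have -> : (u - j * b)%:~R = z - j%:~R * (b%:~R + k%:R * w).
    by rewrite zE vE; ring.
  by apply: frac_idealB => //; apply: frac_ideal_intM.
exists i, j; rewrite zE vE -[u](subrK (j * b)) uE; ring.
Qed.

Lemma hermite_basis_norm (J : algC -> Prop) (a k : nat) (b : int) :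
  frac_ideal D J -> (0 < a)%N -> (0 < k)%N -> zbasis J a%:R (b%:~R + k%:R * w) ->
  ideal_norm J (a * k)%:R.
Proof.
move=> fJ a_gt0 k_gt0 bJ.
have /bJ[p [q wa]] := frac_idealM fJ OK_omega (zbasisl bJ).
have /bJ[p' [q' wb]] := frac_idealM fJ OK_omega (zbasisr bJ).
have [_ aE] : 0 = p * a + q * b /\ a%:Z = q * k.
  apply: int_omega_inj; transitivity (w * a%:R); first by ring.
  by rewrite wa; ring.
have q_gt0 : 0 < q by nia.
have [_ + _ _] := omega_matrix_norm_form fJ bJ (zbasis_neq0 fJ bJ) wa wb q_gt0.
rewrite normK_nat; congr (ideal_norm J _).
have q_neq0 : q%:~R != 0 :> rat by rewrite intr_eq0 gt_eqF.
have aRE : a%:R = q%:~R * k%:R :> rat by rewrite -[a%:R]/(a%:Z%:~R) aE; ring.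
by rewrite natrM aRE; field.
Qed.

Lemma hermite_basis_index (J : algC -> Prop) (a k : nat) (b : int) :
  (0 < a)%N -> (0 < k)%N -> zbasis J a%:R (b%:~R + k%:R * w) -> ideal_index D J (a * k).
Proof.
move=> a_gt0 k_gt0 bJ.
exists (fun i : 'I_(a * k) => (i %% a)%N%:R + (i %/ a)%N%:R * w); split.
- by move=> i; apply/OK_omegaP; exists (i %% a)%N, (i %/ a)%N.
- move=> i j /bJ[x [y ijE]]; apply: val_inj => /=.
  have [xE yE] : (i %% a)%N%:Z - (j %% a)%N%:Z = x * a%:Z + y * b
      /\ (i %/ a)%N%:Z - (j %/ a)%N%:Z = y * k%:Z.
    apply: int_omega_inj.
    transitivity ((i %% a)%N%:R + (i %/ a)%N%:R * w
      - ((j %% a)%N%:R + (j %/ a)%N%:R * w)); first by ring.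
    by rewrite ijE; ring.
  have [ik jk] : (i %/ a < k)%N /\ (j %/ a < k)%N.
    by rewrite !ltn_divLR // ![(k * a)%N]mulnC !ltn_ord.
  have div_ij : (i %/ a = j %/ a)%N by apply: eq_small_dvdz ik jk _; rewrite yE dvdz_mull.
  have y0 : y = 0.
    move/esym/eqP: yE; rewrite div_ij subrr mulf_eq0 => /orP[/eqP//|].
    by rewrite eqz_nat eqn0Ngt k_gt0.
  have mod_ij : (i %% a = j %% a)%N.
    apply: (@eq_small_dvdz a); rewrite ?ltn_pmod //.
    by rewrite xE y0 mul0r addr0 dvdz_mull.
  by rewrite (divn_eq i a) (divn_eq j a) div_ij mod_ij.
- move=> z /OK_omegaP[u [v ->]]; set y := (v %/ k)%Z; set x := ((u - y * b) %/ a)%Z.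
  have vE : v = y * k + `|(v %% k)%Z|%N.
    by rewrite gez0_abs ?modz_ge0 -?divz_eq // -lt0n.
  have uE : u = x * a + `|((u - y * b) %% a)%Z|%N + y * b.
    by rewrite gez0_abs ?modz_ge0 -?divz_eq ?subrK // -lt0n.
  have v'_lt : (`|(v %% k)%Z| < k)%N.
    by have := ltz_pmod v (k_gt0 : 0 < k%:Z); have := modz_ge0 v; lia.
  have u'_lt : (`|((u - y * b) %% a)%Z| < a)%N.
    by have := ltz_pmod (u - y * b) (a_gt0 : 0 < a%:Z); have := modz_ge0 (u - y * b); lia.
  move: `|(v %% k)%Z|%N `|((u - y * b) %% a)%Z|%N v'_lt u'_lt vE uE.
  move=> v' u' v'_lt u'_lt vE uE.
  have i_lt : (v' * a + u' < a * k)%N by nia.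
  exists (Ordinal i_lt); apply/bJ; exists x, y => /=.
  rewrite modnMDl modn_small // divnMDl // divn_small // addn0 vE uE; ring.
Qed.

Lemma int_ideal_index (J : algC -> Prop) (r : rat) : int_ideal D J -> ideal_norm J r ->
  exists2 n : nat, ideal_index D J n & r = n%:R.
Proof.
move=> iJ nJ; have [a [k [b [a_gt0 k_gt0 bJ]]]] := int_ideal_hermite_basis iJ.
exists (a * k)%N; first exact: hermite_basis_index bJ.
by apply: ideal_norm_unique nJ (hermite_basis_norm _ a_gt0 k_gt0 bJ);
  apply: int_ideal_frac.
Qed.

(** * Euclidean ideals *)

Lemma Eset_scaleV (I J : algC -> Prop) (z : algC) :
  Eset D I -> frac_ideal D J -> prodset I J z -> z != 0 ->
  Eset D (scaleset z^-1 (prodset I J)).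
Proof.
move=> [fI _] fJ IJz z_neq0; have fIJ := frac_ideal_prod fI fJ.
have Kz := frac_ideal_QF fIJ IJz; split.
  by apply: frac_ideal_scale => //; [apply: QFV | rewrite invr_eq0].
move=> x Ox; exists (x * z); split; last by field.
exact: frac_idealM Ox IJz.
Qed.

Lemma Eset_prodset (I J : algC -> Prop) (y : algC) : Eset D I -> J y -> prodset I J y.
Proof. by case=> _ OI Jy; rewrite -[y]mul1r; apply: prodsetM => //; apply/OI/OK1. Qed.

Lemma ideal_norm_scaleV (I J : algC -> Prop) (z : algC) (rI rJ : rat) :
  QF D z -> z != 0 -> ideal_norm I rI -> ideal_norm J rJ ->
  ideal_norm (scaleset z^-1 (prodset I J)) (rI * (rJ / normK z)).
Proof.
move=> Kz z_neq0 nI nJ; have zV_neq0 : z^-1 != 0 by rewrite invr_eq0.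
have := ideal_norm_scale (QFV Kz) zV_neq0 (ideal_norm_prod nI nJ).
by rewrite normKV // mulrC mulrA.
Qed.

Lemma finvB (I : algC -> Prop) (x y : algC) :
  Defs.finv D I x -> Defs.finv D I y -> Defs.finv D I (x - y).
Proof.
move=> [Kx xI] [Ky yI]; split=> [|z Iz]; first exact: QFB.
by rewrite mulrBl; apply: OKB; [apply: xI | apply: yI].
Qed.

Lemma Eset_finv_int_ideal (I : algC -> Prop) : Eset D I -> int_ideal D (Defs.finv D I).
Proof.
move=> [fI OI]; have finv0 : Defs.finv D I 0.
  by split=> [|z _]; [exact: OK_QF OK0 | rewrite mul0r; exact: OK0].
split=> //.
- by move=> x [_ xI]; rewrite -[x]mulr1; apply/xI/OI/OK1.
- have [d [Od d_neq0 dI]] := frac_ideal_denominator fI.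
  by exists d; split=> //; split=> //; apply: OK_QF.
- by move=> x y fx fy; rewrite -[y]opprK -[- y]sub0r; do !apply: finvB.
- move=> c x Oc [Kx xI]; split=> [|z Iz]; first by apply: QFM => //; apply: OK_QF.
  by rewrite -mulrA; apply/OKM/xI.
Qed.

Lemma Eset_index (I : algC -> Prop) (r : rat) : Eset D I -> ideal_norm I r ->
  exists2 n : nat, ideal_index D (Defs.finv D I) n & r = n%:R^-1.
Proof.
move=> EI nI; have [fI _] := EI.
have [n idx rE] := int_ideal_index (Eset_finv_int_ideal EI) (ideal_norm_finv fI nI).
by exists n; rewrite // -rE invrK.
Qed.

Lemma norm_form_norm_euclidean (J : algC -> Prop) (a b : algC) (r : rat) (A B C : int) :
  int_ideal D J -> norm_form J a b r A B C -> 0 < A -> sqradius A B C < 1 ->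
  norm_euclidean D J.
Proof.
move=> iJ nf A_gt0 rho_lt1; split=> // I EI x IJx nJx.
have [_ nJ _ _] := nf; have r_gt0 := ideal_norm_gt0 nJ.
have [[fI _] fJ] := (EI, int_ideal_frac iJ); have fIJ := frac_ideal_prod fI fJ.
have [c Jc le_rho] := norm_form_cover fJ nf A_gt0 (frac_ideal_QF fIJ IJx).
have Jy := frac_idealN fJ Jc; exists (- c); split=> //.
have IJz := prodsetD IJx (Eset_prodset EI Jy).
have Kz := frac_ideal_QF fIJ IJz.
have z_neq0 : x - c != 0 by rewrite subr_eq0; apply: contra_notN nJx => /eqP->.
have z_lt : normK (x - c) < r by rewrite (le_lt_trans le_rho) // gtr_pMr.
have [rI nI] := ideal_norm_exists fI; have rI_gt0 := ideal_norm_gt0 nI.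
have nI' := ideal_norm_scaleV Kz z_neq0 nI nJ.
have [n idx_n rE] := Eset_index EI nI.
have [m idx_m r'E] := Eset_index (Eset_scaleV EI fJ IJz z_neq0) nI'.
exists m, n; split=> //; rewrite -(ltr_nat rat) -[ltLHS]invrK -[ltRHS]invrK -rE -r'E.
rewrite ltf_pV2 ?posrE ?(ideal_norm_gt0 nI') // ltr_pMr // ltr_pdivlMr ?mul1r //.
by rewrite normK_gt0.
Qed.

Lemma norm_euclidean_euclidean (J : algC -> Prop) :
  norm_euclidean D J -> euclidean_ideal D J.
Proof.
case=> iJ euclJ; split=> //.
have /choice[psi psiP] I :
    exists m : nat, forall n, ideal_index D (Defs.finv D I) n -> m = n.
  have [[n idx_n]|no_idx] := pselect (exists n, ideal_index D (Defs.finv D I) n).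
    by exists n => m idx_m; apply: ideal_index_unique idx_n idx_m; apply: finvB.
  by exists 0%N => n idx_n; case: no_idx; exists n.
exists psi => I EI x IJx nJx.
have [y [Jy [m [n [idx_m idx_n lt_mn]]]]] := euclJ I EI x IJx nJx.
by exists y; rewrite (psiP _ _ idx_m) (psiP _ _ idx_n).
Qed.

Lemma frac_ideal_approx (I : algC -> Prop) (r : rat) (z : algC) :
  frac_ideal D I -> ideal_norm I r -> QF D z ->
  exists2 x, I x & normK (z - x) <= r * absdisc%:~R.
Proof.
move=> fI nI Kz; have [a [b [r' [A [B [C [nf redQ]]]]]]] := reduced_norm_form_exists fI.
have [_ nI' discE _] := nf; have r'E := ideal_norm_unique nI' nI.
rewrite {r' nI'}r'E in nf.
have [A_gt0 _ _ leAC] := and4P redQ.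
have [x Ix le_rho] := norm_form_cover fI nf A_gt0 Kz.
exists x; rewrite // (le_trans le_rho) // ler_pM2l ?(ideal_norm_gt0 nI) //.
have redQ' : qform_reduced (A%:~R : rat) B%:~R C%:~R by rewrite qform_reduced_int.
rewrite (le_trans (ltW (qform_sqradius_lt redQ'))) // ler_int.
have := qform_reduced_absdisc redQ'.
by rewrite qform_absdisc_int discE -rmorphM -rmorphMn ler_int => ?; nia.
Qed.

Definition deep_hole (J : algC -> Prop) (r : rat) (h : algC) (e : rat) : Prop :=
  [/\ QF D h, 0 < e & forall x, QF D x -> normK (h - x) <= e ->
      forall c, J c -> r <= normK (x - c)].

Lemma norm_form_deep_hole (J : algC -> Prop) (a b : algC) (r : rat) (A B C : int) :
  frac_ideal D J -> norm_form J a b r A B C -> qform_reduced A B C ->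
  1 < sqradius A B C -> exists h e, deep_hole J r h e.
Proof.
move=> fJ nf redQ rho_gt1; have [_ nJ _ _] := nf; have r_gt0 := ideal_norm_gt0 nJ.
have [h Kh hole] := norm_form_hole fJ nf redQ.
have [|e e_gt0 perturb] := normK_perturb (n := r) (m := r * sqradius A B C) r_gt0.
  by rewrite ltr_pMr.
exists h, e; split=> // x Kx near_h c Jc.
have -> : x - c = h - c - (h - x) by ring.
apply: perturb; rewrite ?normKN ?hole //; last exact/QFN/QFB.
by apply: QFB => //; apply: frac_ideal_QF Jc.
Qed.

Lemma deep_hole_descent (J I : algC -> Prop) (r rI e : rat) (h : algC)
    (psi : (algC -> Prop) -> nat) :
    int_ideal D J -> ideal_norm J r -> deep_hole J r h e -> euclid_alg D J psi ->
    Eset D I -> ideal_norm I rI -> rI * r * absdisc%:~R <= e ->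
  exists L rL, [/\ Eset D L, ideal_norm L rL, rL <= rI & (psi L < psi I)%N].
Proof.
move=> iJ nJ [Kh e_gt0 far] alg EI nI small.
have [[fI _] fJ] := (EI, int_ideal_frac iJ); have fIJ := frac_ideal_prod fI fJ.
have r_gt0 := ideal_norm_gt0 nJ.
have [x IJx x_near] := frac_ideal_approx fIJ (ideal_norm_prod nI nJ) Kh.
have Kx := frac_ideal_QF fIJ IJx; have {far} far := far x Kx (le_trans x_near small).
have nJx : ~ J x by move/far; rewrite subrr normK0 leNgt r_gt0.
have [y [Jy lt_psi]] := alg I EI x IJx nJx.
have IJz := prodsetD IJx (Eset_prodset EI Jy).
have z_ge : r <= normK (x + y) by rewrite -[y]opprK; apply/far/(frac_idealN fJ).
have z_neq0 : x + y != 0 by apply/eqP => z0; move: z_ge; rewrite z0 normK0 leNgt r_gt0.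
have Kz := frac_ideal_QF fIJ IJz.
exists (scaleset (x + y)^-1 (prodset I J)), (rI * (r / normK (x + y))); split=> //.
- exact: Eset_scaleV.
- exact: ideal_norm_scaleV.
- by rewrite ger_pMr ?(ideal_norm_gt0 nI) // ler_pdivrMr ?mul1r // normK_gt0.
Qed.

Lemma Eset_small_norm (e : rat) : 0 < e ->
  exists I rI, [/\ Eset D I, ideal_norm I rI & rI <= e].
Proof.
move=> e_gt0; pose k := (Num.bound e^-1).+1.
have k_neq0 : k%:R != 0 :> algC by rewrite pnatr_eq0.
have Kk : QF D k%:R := QF_int k.
have kV_neq0 : (k%:R : algC)^-1 != 0 by rewrite invr_eq0.
exists (scaleset k%:R^-1 (OK D)), (normK k%:R^-1 * 1); split.
- split=> [|x Ox]; first by apply: frac_ideal_scale frac_ideal_OK => //; apply: QFV.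
  by exists (k%:R * x); rewrite mulKf //; split=> //; apply: OKM => //; apply: (OK_int k).
- by apply: ideal_norm_scale ideal_norm_OK => //; apply: QFV.
have k_gt : e^-1 < k%:R.
  by rewrite (lt_le_trans (archi_boundP _)) ?ler_nat // invr_ge0 ltW.
rewrite mulr1 normKV // normK_nat -[e]invrK lef_pV2 ?posrE ?invr_gt0 ?exprn_gt0 ?ltr0n //.
by rewrite (le_trans (ltW k_gt)) // expr2 ler_peMr ?ler0n // ler1n.
Qed.

Lemma deep_hole_not_euclidean (J : algC -> Prop) (r e : rat) (h : algC) :
  ideal_norm J r -> deep_hole J r h e -> ~ euclidean_ideal D J.
Proof.
move=> nJ holeJ [iJ [psi alg]]; have r_gt0 := ideal_norm_gt0 nJ.
have disc_gt0 : (0 : rat) < absdisc%:~R by rewrite ltr0z absdisc_gt0.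
have no_small n I rI : (psi I <= n)%N -> Eset D I -> ideal_norm I rI ->
    rI * r * absdisc%:~R <= e -> False.
  elim: n I rI => [|n IHn] I rI le_n EI nI small;
    have [L [rL [EL nL le_r lt_psi]]] := deep_hole_descent iJ nJ holeJ alg EI nI small.
    by have := leq_trans lt_psi le_n.
  apply: IHn EL nL _; first by rewrite -ltnS (leq_trans lt_psi).
  by apply: le_trans small; rewrite !ler_pM2r.
have [_ e_gt0 _] := holeJ.
have [|I [rI [EI nI le_r]]] := @Eset_small_norm (e / (r * absdisc%:~R)).
  by rewrite divr_gt0 ?mulr_gt0.
by apply: no_small (leqnn _) EI nI _; rewrite -mulrA -ler_pdivlMr ?mulr_gt0.
Qed.

(** * Ideal classes *)

Lemma ideal_equivP (I J : algC -> Prop) :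
  ideal_equiv D I J <-> exists a, [/\ QF D a, a != 0 & J = scaleset a I].
Proof.
split=> [[a [Ka a_neq0 JE]]|[a [Ka a_neq0 ->]]]; exists a; split=> //.
by apply/predeqP.
Qed.

Lemma ideal_equiv_refl (I : algC -> Prop) : ideal_equiv D I I.
Proof.
exists 1; split=> [||z]; [exact: (QF_int 1) | exact: oner_neq0 |].
by split=> [Iz|[x [Ix ->]]]; [exists z|]; rewrite mul1r.
Qed.

Lemma ideal_equiv_sym (I J : algC -> Prop) : ideal_equiv D I J -> ideal_equiv D J I.
Proof.
case=> a [Ka a_neq0 JE]; exists a^-1; split; [exact: QFV | by rewrite invr_eq0 |].
move=> z; split=> [Iz|[_ [/JE[x [Ix ->]] ->]]]; last by rewrite mulKf.
by exists (a * z); rewrite mulKf //; split=> //; apply/JE; exists z.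
Qed.

Lemma ideal_equiv_trans (J I L : algC -> Prop) :
  ideal_equiv D I J -> ideal_equiv D J L -> ideal_equiv D I L.
Proof.
move=> [a [Ka a_neq0 JE]] [b [Kb b_neq0 LE]]; exists (b * a).
split=> [||z]; [exact: QFM | exact: mulf_neq0 | split].
  by move=> /LE[_ [/JE[x [Ix ->]] ->]]; exists x; rewrite mulrA.
case=> x [Ix ->]; apply/LE; exists (a * x); rewrite mulrA; split=> //.
by apply/JE; exists x.
Qed.

Lemma norm_form_principal (I : algC -> Prop) (a b : algC) (r : rat) (B C : int) :
  frac_ideal D I -> norm_form I a b r 1 B C -> ideal_equiv D (OK D) I.
Proof.
move=> fI nf; have [bI [_ Ir _] _ _] := nf; have Ia := zbasisl bI.
have [norm_a _ _] := norm_form_gram nf; rewrite mulr1 in norm_a.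
have [Ka a_neq0] := (frac_ideal_QF fI Ia, zbasis_neq0 fI bI).
exists a; split=> // z; split=> [Iz|[x [Ox ->]]]; last first.
  by rewrite mulrC; apply: frac_idealM.
exists (z / a); split; last by rewrite mulrC divfK.
have := Ir z a Iz Ia; rewrite -norm_a normKE //; congr (OK D _).
by field; rewrite conjC_eq0 a_neq0.
Qed.

Lemma principal_norm (I : algC -> Prop) (r : rat) :
  ideal_equiv D (OK D) I -> ideal_norm I r -> exists2 x, I x & normK x = r.
Proof.
case/ideal_equivP=> a [Ka a_neq0 ->] nI; exists a.
  by exists 1; rewrite mulr1; split=> //; exact: OK1.
have := ideal_norm_unique (ideal_norm_scale Ka a_neq0 ideal_norm_OK) nI.
by rewrite mulr1.
Qed.

Lemma prodset_OKl (C : algC -> Prop) : frac_ideal D C -> prodset (OK D) C = C.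
Proof.
move=> fC; apply/predeqP => z; split=> [|Cz]; last first.
  by rewrite -[z]mul1r; apply: prodsetM => //; apply: OK1.
apply: prodset_ind; [exact: frac_ideal0 | exact: frac_idealD | exact: frac_idealM].
Qed.

Lemma principal_prod (I J : algC -> Prop) : ideal_equiv D (OK D) I ->
  ideal_equiv D (OK D) J -> ideal_equiv D (OK D) (prodset I J).
Proof.
case/ideal_equivP=> a [Ka a_neq0 ->] /ideal_equivP[b [Kb b_neq0 ->]].
exists (a * b); split=> [||z]; [exact: QFM | exact: mulf_neq0 | split].
  apply: prodset_ind => [|_ _ [x [Ox ->]] [y [Oy ->]]|_ _ [x [Ox ->]] [y [Oy ->]]].
  - by exists 0; rewrite mulr0; split=> //; exact: OK0.
  - by exists (x + y); rewrite mulrDr; split=> //; apply: OKD.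
  - by exists (x * y); rewrite mulrACA; split=> //; apply: OKM.
case=> x [Ox ->]; rewrite -[x]mulr1 mulrACA.
by apply: prodsetM; [exists x | exists 1; split=> //; exact: OK1].
Qed.

Lemma principal_generates (C I : algC -> Prop) : ideal_equiv D (OK D) C ->
  generates_class_group D C -> frac_ideal D I -> ideal_equiv D (OK D) I.
Proof.
move=> princC genC fI; have [k Ik] := genC I fI.
apply: ideal_equiv_trans (ideal_equiv_sym Ik).
elim: k {Ik} => [|k IHk] /=; first exact: ideal_equiv_refl.
exact: principal_prod.
Qed.

Lemma zbasis_ratio_equiv (I J : algC -> Prop) (a b a' b' : algC) :
  frac_ideal D I -> frac_ideal D J -> zbasis I a b -> zbasis J a' b' ->
  b' / a' = b / a -> ideal_equiv D I J.
Proof.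
move=> fI fJ bI bJ ratioE.
have [a_neq0 a'_neq0] := (zbasis_neq0 fI bI, zbasis_neq0 fJ bJ).
have [Ka Ka'] := (frac_ideal_QF fI (zbasisl bI), frac_ideal_QF fJ (zbasisl bJ)).
have b'E : b' = a' / a * b by rewrite -[LHS](divfK a'_neq0) ratioE; ring.
exists (a' / a); split=> [||z]; [exact/QFM/QFV | by rewrite mulf_neq0 ?invr_eq0 | split].
  case/bJ=> x [y ->]; exists (x%:~R * a + y%:~R * b).
  split; first by apply/bI; exists x, y.
  by rewrite b'E; field.
by case=> _ [/bI[x [y ->]] ->]; apply/bJ; exists x, y; rewrite b'E; field.
Qed.

Lemma norm_form_root (I : algC -> Prop) (a b : algC) (r : rat) (A B C : int) :
  frac_ideal D I -> norm_form I a b r A B C ->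
  A%:~R * (b / a) ^+ 2 - B%:~R * (b / a) + C%:~R = 0.
Proof.
move=> fI nf; have [bI /ideal_norm_gt0/ratC_neq0 r_neq0 _ _] := nf.
have [Ka Kb] := (frac_ideal_QF fI (zbasisl bI), frac_ideal_QF fI (zbasisr bI)).
have a_neq0 := zbasis_neq0 fI bI; have [normA polarB normC] := norm_form_gram nf.
have AE : ratC r * A%:~R = a * a^* by rewrite -normKE // normA (rmorphM ratC) /= ratr_int.
have BE : ratC r * B%:~R = a * b^* + b * a^*.
  by rewrite -polarKE // polarB (rmorphM ratC) /= ratr_int.
have CE : ratC r * C%:~R = b * b^* by rewrite -normKE // normC (rmorphM ratC) /= ratr_int.
apply: (mulfI r_neq0).
transitivity (ratC r * A%:~R * (b / a) ^+ 2 - ratC r * B%:~R * (b / a)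
  + ratC r * C%:~R); first by ring.
by rewrite AE BE CE; field.
Qed.

Lemma norm_form_ratio (I J : algC -> Prop) (a b a' b' : algC) (r r' : rat) (A B C : int) :
  frac_ideal D I -> frac_ideal D J -> 0 < A ->
  norm_form I a b r A B C -> norm_form J a' b' r' A B C ->
  b' / a' = b / a \/
  b' / a' = B%:~R / A%:~R - b / a /\ (b / a) * (b' / a') = C%:~R / A%:~R.
Proof.
move=> fI fJ A_gt0 /(norm_form_root fI) + /(norm_form_root fJ).
move: (b / a) (b' / a') => t t' root_t root_t'.
have A_neq0 : A%:~R != 0 :> algC by rewrite intr_eq0 gt_eqF.
have /eqP : (t' - t) * (A%:~R * (t' + t) - B%:~R) = 0.
  by rewrite -[RHS](subrr 0) -{1}root_t' -root_t; ring.
rewrite mulf_eq0 !subr_eq0 => /orP[/eqP->|/eqP sumE]; first by left.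
right; have t'E : t' = B%:~R / A%:~R - t by rewrite -sumE; field.
split=> //; have -> : C%:~R = B%:~R * t - A%:~R * t ^+ 2.
  by apply/eqP; rewrite -subr_eq0 -root_t; apply/eqP; ring.
by rewrite t'E; field.
Qed.

(* [b / a] and [b' / a'] are roots of [A X^2 - B X + C]; if they are conjugate,
   a symmetry of the form exchanges them. *)
Lemma ambiguous_norm_form_equiv (I J : algC -> Prop) (a b a' b' : algC) (r r' : rat)
    (A B C : int) : frac_ideal D I -> frac_ideal D J -> 0 < A ->
  norm_form I a b r A B C -> norm_form J a' b' r' A B C ->
  (A %| B)%Z \/ A = C -> ideal_equiv D I J.
Proof.
move=> fI fJ A_gt0 nI nJ ambig; have [bI _ _ _] := nI; have [bJ _ _ _] := nJ.
have [a_neq0 b_neq0] := (zbasis_neq0 fI bI, zbasis_neq0 fI (zbasis_swap bI)).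
have A_neq0 : A%:~R != 0 :> algC by rewrite intr_eq0 gt_eqF.
have [same|[sumE prodE]] := norm_form_ratio fI fJ A_gt0 nI nJ.
  exact: zbasis_ratio_equiv bI bJ same.
case: ambig => [/dvdzP[m BE]|CE].
  apply: zbasis_ratio_equiv (zbasis_subr m bI) bJ _ => //.
  by rewrite sumE BE; field; apply/andP.
apply: zbasis_ratio_equiv (zbasis_swap bI) bJ _ => //.
rewrite CE divff // -?CE // in prodE.
apply: (mulfI (_ : b / a != 0)); first by rewrite mulf_neq0 ?invr_eq0.
by rewrite prodE; field; apply/andP.
Qed.

Definition omega_ideal (a : nat) (b : int) (z : algC) : Prop :=
  exists x y : int, z = x%:~R * a%:R + y%:~R * (b%:~R + w).

Lemma int_ideal_omega_ideal (a : nat) (b : int) : (0 < a)%N ->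
  (a %| b ^+ 2 + omega_tr * b + omega_nrm)%Z -> int_ideal D (omega_ideal a b).
Proof.
move=> a_gt0 /dvdzP[c normE]; split.
- move=> _ [x [y ->]]; apply/OK_omegaP; exists (x * a%:Z + y * b), y; ring.
- by exists 0, 0; ring.
- by exists a%:R; rewrite pnatr_eq0 -lt0n; split=> //; exists 1, 0; ring.
- by move=> _ _ [x [y ->]] [x' [y' ->]]; exists (x + x'), (y + y'); ring.
move=> _ _ /OK_omegaP[u [v ->]] [x [y ->]].
exists (u * x - v * x * b - v * y * c), (u * y + v * x * a%:Z + v * y * (b + omega_tr)).
transitivity ((u * x * a + u * y * b)%:~R + (u * y + v * x * a + v * y * b)%:~R * w
  + (v * y)%:~R * w ^+ 2); first by ring.
have nrmE : omega_nrm = c * a - b ^+ 2 - omega_tr * b by rewrite -normE; ring.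
by rewrite omega_sqr nrmE; ring.
Qed.

Lemma omega_ideal_norm (a : nat) (b : int) : (0 < a)%N ->
  (a %| b ^+ 2 + omega_tr * b + omega_nrm)%Z -> ideal_norm (omega_ideal a b) a%:R.
Proof.
move=> a_gt0 a_dvd; have fI := int_ideal_frac (int_ideal_omega_ideal a_gt0 a_dvd).
have := @hermite_basis_norm _ a 1 b fI a_gt0 isT; rewrite muln1 mul1r; exact.
Qed.

(** * The seven fields *)

Local Notation euclidean_radicands := [:: 1; 2; 3; 5; 7; 11; 15]%N.
Local Notation class_one_radicands := [:: 1; 2; 3; 7; 11]%N.
Local Notation class_two_radicands := [:: 5; 15]%N.

Lemma qform_sqradius_int (A B C : int) :
  sqradius A B C = (A * C * (A + C - B))%:~R / (qform_absdisc A B C)%:~R.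
Proof. by rewrite /qform_sqradius qform_absdisc_int !(rmorphB, rmorphD, rmorphM). Qed.

Section Enumeration.
Variables (A B C : int).
Hypotheses (redQ : qform_reduced A B C) (discE : qform_absdisc A B C = absdisc).

Lemma sqradius_lt1 : (sqradius A B C < 1) = (A * C * (A + C - B) < absdisc).
Proof.
by rewrite qform_sqradius_int discE ltr_pdivrMr ?ltr0z ?absdisc_gt0 // mul1r ltr_int.
Qed.

Lemma sqradius_gt1 : (1 < sqradius A B C) = (absdisc < A * C * (A + C - B)).
Proof.
by rewrite qform_sqradius_int discE ltr_pdivlMr ?ltr0z ?absdisc_gt0 // mul1r ltr_int.
Qed.

Lemma reduced_sqradius_gt1 : D \notin euclidean_radicands -> 1 < sqradius A B C.
Proof.
rewrite !inE !negb_or sqradius_gt1 => /and5P[D1 D2 D3 D5 /and3P[D7 D11 D15]].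
have /and4P[A_gt0 B_ge0 leBA leAC] := redQ; have := discE; rewrite /qform_absdisc => disc.
have D_mod4 := sqfree_mod4.
have D_mod9 : (D %% 9 != 0)%N := D_sqfree (isT : prime 3).
have [C_ge4|C_lt4] := leP 4 C.
  rewrite -disc; have AC_gt0 : 0 < A * C by nia.
  have [->|B_neq0] := eqVneq B 0; first by nia.
  have : A * C * 4 <= A * C * (A + C - B) by rewrite ler_pM2l //; lia.
  by nia.
have A_cases : A = 1 \/ A = 2 \/ A = 3 by lia.
have B_cases : B = 0 \/ B = 1 \/ B = 2 \/ B = 3 by lia.
have C_cases : C = 1 \/ C = 2 \/ C = 3 by lia.
move: disc leBA leAC; rewrite /absdisc.
clear - A_cases B_cases C_cases D1 D2 D3 D5 D7 D11 D15 D_mod4 D_mod9.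
by case: A_cases => [->|[->|->]]; case: B_cases => [->|[->|[->|->]]];
   case: C_cases => [->|[->|->]]; case: eqP => ?; lia.
Qed.

Lemma reduced_form_cases : D \in euclidean_radicands ->
  A = 1 \/
  D \in class_two_radicands /\ (A, B, C) = if D == 5%N then (2, 2, 3) else (2, 1, 2).
Proof.
move=> D_in; have /and4P[A_gt0 B_ge0 leBA leAC] := redQ.
have := discE; rewrite /qform_absdisc => disc.
have disc_le20 : absdisc <= 20.
  by rewrite /absdisc; case: ifP; move: D_in; rewrite !inE; lia.
have A_le2 : A <= 2 by nia.
have [A1|A2] : A = 1 \/ A = 2 by lia.
  by left.
right; have B_cases : B = 0 \/ B = 1 \/ B = 2 by lia.
have C_cases : C = 2 \/ C = 3 by rewrite A2 in disc; nia.
move: D_in disc; rewrite !inE /absdisc A2.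
case: B_cases => [->|[->|->]]; case: C_cases => ->; case: ifP => D_mod4 D_in disc;
  try (exfalso; lia).
- by have -> : D = 15%N by lia.
- by have -> : D = 5%N by lia.
Qed.

Lemma reduced_principal_form : A = 1 -> B = omega_tr /\ C = omega_nrm.
Proof.
move=> A1; have := discE; rewrite /qform_absdisc A1 => disc.
have /and4P[_ B_ge0 leBA _] := redQ.
have B01 : B = 0 \/ B = 1 by lia.
have tr01 : omega_tr = 0 \/ omega_tr = 1 by rewrite /omega_tr; lia.
by move: disc; rewrite absdiscE; case: B01 => ->; case: tr01 => ->; lia.
Qed.

Lemma reduced_sqradius_lt1 : D \in euclidean_radicands ->
  A <> 1 \/ D \notin class_two_radicands -> sqradius A B C < 1.
Proof.
move=> D_in D_or; rewrite sqradius_lt1.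
have [A1|[D_in2 formE]] := reduced_form_cases D_in.
  case: D_or => // D_notin; have [-> ->] := reduced_principal_form A1.
  rewrite A1 /omega_tr /omega_nrm /absdisc; move: D_in D_notin; rewrite !inE.
  by do ![case: eqP => [->|_] //].
by move: D_in2 formE; rewrite /absdisc !inE => /orP[]/eqP-> [-> -> ->].
Qed.

End Enumeration.

Lemma euclidean_ideal_radicand (J : algC -> Prop) :
  euclidean_ideal D J -> D \in euclidean_radicands.
Proof.
move=> euclJ; apply: contrapT => /negP D_notin.
have [iJ _] := euclJ; have fJ := int_ideal_frac iJ.
have [a [b [r [A [B [C [nf redQ]]]]]]] := reduced_norm_form_exists fJ.
have [_ nJ discE _] := nf.
have rho_gt1 := reduced_sqradius_gt1 redQ discE D_notin.
have [h [e holeJ]] := norm_form_deep_hole fJ nf redQ rho_gt1.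
exact: deep_hole_not_euclidean nJ holeJ euclJ.
Qed.

Lemma normK_OK_neq2 (x : algC) : D \in class_two_radicands -> OK D x -> normK x <> 2.
Proof.
move=> D_in /OK_omegaP[u [v ->]]; rewrite normK_int_omega => /eqP.
rewrite (eqr_int rat _ 2) => /eqP.
have sqr_neq2 (m : int) : m ^+ 2 <> 2.
  move=> m2; have : m = -1 \/ m = 0 \/ m = 1 by nia.
  by case=> [|[|]] m_eq; rewrite m_eq in m2.
have [[-> ->]|[-> ->]] : omega_tr = 0 /\ omega_nrm = 5 \/ omega_tr = 1 /\ omega_nrm = 4.
  rewrite /omega_tr /omega_nrm; move: D_in; rewrite !inE.
  by case/orP=> /eqP->; [left | right].
- move=> norm2; have v0 : v = 0 by nia.
  by apply: (sqr_neq2 u); rewrite -norm2 v0; ring.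
- move=> norm2; have norm8 : (2 * u + v) ^+ 2 + 15 * v ^+ 2 = 8.
    by transitivity (4 * (u ^+ 2 + 1 * u * v + 4 * v ^+ 2)); [ring | rewrite norm2].
  have v0 : v = 0 by have := sqr_ge0 (2 * u + v); nia.
  by apply: (sqr_neq2 u); rewrite -norm2 v0; ring.
Qed.

(* The ideal [(2, 1 + w)]; [1 + w] has norm 6 both for [D = 5] and for [D = 15]. *)
Local Notation ideal_over_2 := (omega_ideal 2 1).

Lemma dvd_norm_omega1 : D \in class_two_radicands ->
  (2 %| 1 ^+ 2 + omega_tr * 1 + omega_nrm)%Z.
Proof. by rewrite /omega_tr /omega_nrm !inE => /orP[]/eqP->. Qed.

Lemma int_ideal_over_2 : D \in class_two_radicands -> int_ideal D ideal_over_2.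
Proof. by move/dvd_norm_omega1/(int_ideal_omega_ideal (a := 2) isT). Qed.

Lemma ideal_over_2_nonprincipal : D \in class_two_radicands ->
  ~ ideal_equiv D (OK D) ideal_over_2.
Proof.
move=> D_in /principal_norm norm_gen; have [OP2 _ _ _ _] := int_ideal_over_2 D_in.
have [x /OP2 Ox x_norm] :=
  norm_gen _ (omega_ideal_norm (a := 2) isT (dvd_norm_omega1 D_in)).
exact: normK_OK_neq2 Ox x_norm.
Qed.

Lemma class_number_one_principal (I : algC -> Prop) :
  D \in class_one_radicands -> frac_ideal D I -> ideal_equiv D (OK D) I.
Proof.
move=> D_in fI; have [a [b [r [A [B [C [nf redQ]]]]]]] := reduced_norm_form_exists fI.
have [_ _ discE _] := nf; have [|A1|[D_in2 _]] := reduced_form_cases redQ discE.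
- by move: D_in; rewrite !inE; lia.
- by rewrite A1 in nf; apply: norm_form_principal nf.
- by move: D_in D_in2; rewrite !inE; lia.
Qed.

Lemma class_number_two_cases (I : algC -> Prop) :
  D \in class_two_radicands -> frac_ideal D I ->
  ideal_equiv D (OK D) I \/ ideal_equiv D ideal_over_2 I.
Proof.
move=> D_in fI; have D_in7 : D \in euclidean_radicands.
  by move: D_in; rewrite !inE; lia.
have [a [b [r [A [B [C [nf redQ]]]]]]] := reduced_norm_form_exists fI.
have [_ _ discE _] := nf.
have [A1|[_ formE]] := reduced_form_cases redQ discE D_in7.
  by left; rewrite A1 in nf; apply: norm_form_principal nf.
have fP := int_ideal_frac (int_ideal_over_2 D_in).
have [a' [b' [r' [A' [B' [C' [nf' redQ']]]]]]] := reduced_norm_form_exists fP.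
have [_ _ discE' _] := nf'.
have [A'1|[_ formE']] := reduced_form_cases redQ' discE' D_in7.
  rewrite A'1 in nf'; case: (ideal_over_2_nonprincipal D_in).
  exact: norm_form_principal nf'.
right; move: formE'; rewrite -formE => -[A'E B'E C'E]; rewrite A'E B'E C'E in nf'.
have [A_gt0 _ _ _] := and4P redQ.
apply: ambiguous_norm_form_equiv nf' nf _ => //.
by case: eqP formE => _ [-> -> ->]; [left | right].
Qed.

Lemma class_number_one : D \in class_one_radicands -> has_class_number D 1.
Proof.
move=> D_in; exists (fun=> OK D); split=> [_|i j _|I fI]; first exact: frac_ideal_OK.
  by rewrite !ord1.
by exists ord0; apply/ideal_equiv_sym/class_number_one_principal.
Qed.

Lemma class_number_two : D \in class_two_radicands -> has_class_number D 2.
Proof.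
move=> D_in; exists (fun i : 'I_2 => if i == ord0 then OK D else ideal_over_2).
split=> [i|i j|I fI].
- by case: ifP => _; [exact: frac_ideal_OK | exact/int_ideal_frac/int_ideal_over_2].
- have nP := ideal_over_2_nonprincipal D_in.
  case: i j => [[|[|//]] ?] [[|[|//]] ?] //= e; apply: val_inj => //=; case: nP => //.
  exact: ideal_equiv_sym.
- have [eI|eI] := class_number_two_cases D_in fI; [exists ord0 | exists ord_max];
    exact: ideal_equiv_sym.
Qed.

Lemma class_group_generator : D \in euclidean_radicands ->
  exists2 C, int_ideal D C & generates_class_group D C.
Proof.
move=> D_in; have [D_in2|D_in1] := boolP (D \in class_two_radicands).
  exists ideal_over_2 => [|I fI]; first exact: int_ideal_over_2.
  have [eI|eI] := class_number_two_cases D_in2 fI; [exists 0%N | exists 1%N].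
    exact: ideal_equiv_sym.
  by rewrite /= prodset_OKl;
    [apply: ideal_equiv_sym | apply/int_ideal_frac/int_ideal_over_2].
exists (OK D) => [|I fI]; first exact: int_ideal_OK.
exists 0%N; apply/ideal_equiv_sym/class_number_one_principal => //.
by move: D_in D_in1; rewrite !inE; lia.
Qed.

Lemma generator_norm_euclidean (J : algC -> Prop) : D \in euclidean_radicands ->
  int_ideal D J -> generates_class_group D J -> norm_euclidean D J.
Proof.
move=> D_in iJ genJ; have fJ := int_ideal_frac iJ.
have [a [b [r [A [B [C [nf redQ]]]]]]] := reduced_norm_form_exists fJ.
have [_ _ discE _] := nf.
have [A_gt0 _ _ _] := and4P redQ; apply: (norm_form_norm_euclidean iJ nf A_gt0).
apply: (reduced_sqradius_lt1 redQ discE D_in).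
have [D_in2|] := boolP (D \in class_two_radicands); last by right.
left=> A1; rewrite A1 in nf; apply: (ideal_over_2_nonprincipal D_in2).
apply: principal_generates genJ _; first exact: norm_form_principal nf.
exact/int_ideal_frac/int_ideal_over_2.
Qed.

End ImaginaryQuadraticField.

Theorem theorem1p1 (D : nat) (hD : (0 < D)%N) (hsq : squarefree D) :
  (has_euclidean_ideal D <-> D \in [:: 1; 2; 3; 5; 7; 11; 15]%N)
  /\ (D \in [:: 1; 2; 3; 7; 11]%N -> has_class_number D 1)
  /\ (D \in [:: 5; 15]%N -> has_class_number D 2)
  /\ (D \in [:: 1; 2; 3; 5; 7; 11; 15]%N ->
        forall C : algC -> Prop, int_ideal D C ->
          generates_class_group D C -> norm_euclidean D C).
Proof.
split; [split=> [[C euclC]|D_in] | split; [|split]].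
- exact: euclidean_ideal_radicand euclC.
- have [C iC genC] := class_group_generator hD hsq D_in.
  by exists C; apply/norm_euclidean_euclidean/generator_norm_euclidean.
- exact: class_number_one.
- exact: class_number_two.
- by move=> D_in C; apply: generator_norm_euclidean.
Qed.
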